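(* Let $G$ be a simply connected five dimensional nilpotent Lie group with a left invariant Riemannian metric $\tilde a$, whose Lie algebra $\mathfrak l_{5,7}$ has an $\tilde a$-orthonormal basis $\{E_1,\dots,E_5\}$ with non-zero brackets $[E_1,E_2]=aE_3+bE_4+cE_5$, $[E_1,E_3]=dE_4+fE_5$, $[E_1,E_4]=gE_5$, where $a,d,g>0$ and either $b>0$, or $b=0$ and $f\ge0$. Let $F(x,y)=\sqrt{\tilde a(y,y)}+\tilde a(X(x),y)$ be a Randers metric of Douglas type on $G$, where $X$ is a left invariant vector field with $\sqrt{\tilde a(X,X)}<1$. Then a non-zero vector $Y=y_1E_1+y_2E_2+y_3E_3+y_4E_4+y_5E_5$ is a geodesic vector of $(G,F)$ if and only if $Y\in\operatorname{span}\{E_1,E_2\}$, or $Y$ is orthogonal to $E_1$ and $y_2(ay_3+by_4+cy_5)+y_3(dy_4+fy_5)+gy_4y_5=0$.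
   Context: Brackets of basis elements not listed (and not obtained by antisymmetry) are zero. Orthogonality is with respect to $\tilde a$. The spray coefficients of $F$ in standard local coordinates $(x,y)$ of the tangent bundle are $G^i=\frac14 g^{il}\big([F^2]_{x^my^l}y^m-[F^2]_{x^l}\big)$, where $g_{ij}=\frac12\frac{\partial^2F^2}{\partial y^i\partial y^j}$. $F$ is of Douglas type if in every standard local coordinate system $G^i=\frac12\Gamma^i_{jk}(x)y^jy^k+P(x,y)y^i$ for some functions $\Gamma^i_{jk}(x)$ and some local function $P(x,y)$ positively homogeneous of degree one in $y$. A non-zero vector $Y$ of the Lie algebra is a geodesic vector of $(G,F)$ if the curve $t\mapsto\exp(tY)$ is a geodesic of $(G,F)$. *)

(* Defs.v *)
From HB Require Import structures.
From mathcomp Require Import all_boot all_order all_algebra.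
From mathcomp Require Import all_classical all_reals all_analysis.

Set Implicit Arguments.
Unset Strict Implicit.
Unset Printing Implicit Defensive.

Import Order.TTheory GRing.Theory Num.Theory numFieldNormedType.Exports.

Local Open Scope classical_set_scope.
Local Open Scope ring_scope.

(* Meant for open [A] in finite dimension: [f] is C^(k+1) iff it is
   differentiable and every x |-> f'(x) v is C^k. *)
Fixpoint Ck_on (R : realType) (U W : normedModType R) (k : nat)
    (A : set U) (f : U -> W) : Prop :=
  match k with
  | 0 => forall x, A x -> {for x, continuous f}
  | k'.+1 => (forall x, A x -> differentiable f x) /\
             (forall v, Ck_on k' A (fun x => 'd f x v))
  end.

Definition smooth_on (R : realType) (U W : normedModType R)
    (A : set U) (f : U -> W) : Prop :=
  forall k, Ck_on k A f.

(* [cinv] is total; its values outside the image of the chart are irrelevant. *)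
Record chart (R : realType) (n : nat) (T : topologicalType) := Chart {
  cdom : set T;
  cmap : T -> 'rV[R]_n;
  cinv : 'rV[R]_n -> T;
  cdom_open : open cdom;
  cimg_open : open (cmap @` cdom);
  cmap_continuous : {in cdom, continuous cmap};
  cinv_continuous : {in cmap @` cdom, continuous cinv};
  cmapK : {in cdom, cancel cmap cinv}
}.

Definition cimg (R : realType) (n : nat) (T : topologicalType)
  (c : chart R n T) : set 'rV[R]_n := cmap c @` cdom c.

Definition smooth_transition (R : realType) (n : nat) (T : topologicalType)
    (c c' : chart R n T) : Prop :=
  smooth_on (cmap c @` (cdom c `&` cdom c')) (cmap c' \o cinv c).

(* [atlas] is the maximal atlas: its elements are all the local coordinate
   systems of the manifold. *)
HB.mixin Record isLieGroup (R : realType) (n : nat) G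
    of Topological G & Group G := {
  atlas : set (chart R n G);
  atlas_cover : forall p : G, exists2 c, atlas c & cdom c p;
  atlas_compatible :
    forall c c', atlas c -> atlas c' -> smooth_transition c c';
  atlas_maximal : forall c,
    (forall c', atlas c' -> smooth_transition c c' /\ smooth_transition c' c) ->
    atlas c;
  lie_hausdorff : hausdorff_space G;
  lie_second_countable : @second_countable G;
  lie_mul_continuous : continuous (fun pq : G * G => (pq.1 * pq.2)%g);
  lie_inv_continuous : continuous (fun p : G => (p^-1)%g);
  lie_mul_smooth : forall c1 c2 c3, atlas c1 -> atlas c2 -> atlas c3 ->
    smooth_on
      [set uv : 'rV[R]_n * 'rV[R]_n |
         [/\ cimg c1 uv.1, cimg c2 uv.2
           & cdom c3 (cinv c1 uv.1 * cinv c2 uv.2)%g]]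
      (fun uv => cmap c3 (cinv c1 uv.1 * cinv c2 uv.2)%g);
  lie_inv_smooth : forall c1 c2, atlas c1 -> atlas c2 ->
    smooth_on [set u | cimg c1 u /\ cdom c2 ((cinv c1 u)^-1)%g]
      (fun u => cmap c2 ((cinv c1 u)^-1)%g)
}.

#[short(type="lieGroupType")]
HB.structure Definition LieGroup (R : realType) (n : nat) :=
  {G of Topological G & Group G & isLieGroup R n G}.

Definition unit_interval (R : realType) : set R := [set t | 0 <= t <= 1].
Arguments unit_interval : clear implicits.

Definition path_connected (R : realType) (T : topologicalType) : Prop :=
  forall p q : T, exists gam : R -> T,
    [/\ {within unit_interval R, continuous gam}, gam 0 = p & gam 1 = q].

Definition null_homotopic (R : realType) (T : topologicalType)
    (gam : R -> T) : Prop :=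
  exists H : R * R -> T,
    [/\ {within unit_interval R `*` unit_interval R, continuous H},
        forall t, unit_interval R t -> H (0, t) = gam t,
        forall t, unit_interval R t -> H (1, t) = gam 0
      & forall s, unit_interval R s -> H (s, 0) = gam 0 /\ H (s, 1) = gam 0].

Definition simply_connected (R : realType) (T : topologicalType) : Prop :=
  path_connected R T /\
  forall gam : R -> T, {within unit_interval R, continuous gam} ->
    gam 0 = gam 1 -> null_homotopic gam.

Inductive generated_subgroup (T : groupType) (S : set T) : set T :=
| gen_base x : S x -> generated_subgroup S x
| gen_one : generated_subgroup S 1%g
| gen_mul x y : generated_subgroup S x -> generated_subgroup S y ->
    generated_subgroup S (x * y)%g
| gen_inv x : generated_subgroup S x -> generated_subgroup S (x^-1)%g.

Fixpoint lower_central_series (T : groupType) (k : nat) : set T :=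
  match k with
  | 0 => setT
  | k'.+1 => generated_subgroup
      [set z | exists x y : T, lower_central_series k' x /\ z = [~ x, y]%g]
  end.

Definition nilpotent_group (T : groupType) : Prop :=
  exists k, lower_central_series k = [set 1%g : T].

(* A vector field, a metric or a Finsler function is represented by its
   components in every chart, i.e. [X c p] is the row of components in [c] of
   the vector field [X] at [p].  Values with [c] outside the atlas or [p]
   outside the domain of [c] are irrelevant. *)

Section Fields.
Variables (R : realType) (n : nat) (G : lieGroupType R n).
Local Notation V := 'rV[R]_n.
Local Notation chartG := (chart R n G).

(* The differential at [p] of [f : G -> G], read in [c] at [p] and in [c'] at
   [f p]. *)
Definition tangent_map (f : G -> G) (c c' : chartG) (p : G) : V -> V :=
  'd (cmap c' \o f \o cinv c) (cmap c p).

Definition vfield_eq (X Z : chartG -> G -> V) : Prop :=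
  forall c p, atlas c -> cdom c p -> X c p = Z c p.

Definition is_vfield (X : chartG -> G -> V) : Prop :=
  (forall c c' p, atlas c -> atlas c' -> cdom c p -> cdom c' p ->
     X c' p = tangent_map id c c' p (X c p)) /\
  (forall c, atlas c -> smooth_on (cimg c) (fun x => X c (cinv c x))).

Definition left_invariant_vfield (X : chartG -> G -> V) : Prop :=
  is_vfield X /\
  forall q p c c', atlas c -> atlas c' -> cdom c p -> cdom c' (q * p)%g ->
    X c' (q * p)%g = tangent_map (fun r => (q * r)%g) c c' p (X c p).

(* [X, Z]^i = X^j d_j Z^i - Z^j d_j X^i *)
Definition lie_bracket (X Z : chartG -> G -> V) : chartG -> G -> V :=
  fun c p => 'd (fun x => Z c (cinv c x)) (cmap c p) (X c p)
           - 'd (fun x => X c (cinv c x)) (cmap c p) (Z c p).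

Definition inner (h : chartG -> G -> 'M[R]_n) (c : chartG) (p : G)
  (u v : V) : R := (u *m h c p *m v^T) 0 0.

Definition riemannian_metric (h : chartG -> G -> 'M[R]_n) : Prop :=
  [/\ forall c p, atlas c -> cdom c p -> (h c p)^T = h c p,
      forall c p v, atlas c -> cdom c p -> v != 0 -> 0 < inner h c p v v,
      forall c c' p u v, atlas c -> atlas c' -> cdom c p -> cdom c' p ->
        inner h c' p (tangent_map id c c' p u) (tangent_map id c c' p v)
        = inner h c p u v
    & forall c, atlas c -> smooth_on (cimg c) (fun x => h c (cinv c x))].

Definition left_invariant_metric (h : chartG -> G -> 'M[R]_n) : Prop :=
  riemannian_metric h /\
  forall q p c c' u v, atlas c -> atlas c' -> cdom c p -> cdom c' (q * p)%g ->
    let dL := tangent_map (fun r => (q * r)%g) c c' p in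
    inner h c' (q * p)%g (dL u) (dL v) = inner h c p u v.

Definition orthogonal_vfields (h : chartG -> G -> 'M[R]_n)
    (X Z : chartG -> G -> V) : Prop :=
  forall c p, atlas c -> cdom c p -> inner h c p (X c p) (Z c p) = 0.

(* [n] orthonormal left invariant fields form a basis of the [n]-dimensional
   Lie algebra of left invariant fields. *)
Definition orthonormal_basis (h : chartG -> G -> 'M[R]_n)
    (E : n.-tuple (chartG -> G -> V)) : Prop :=
  (forall i, left_invariant_vfield (tnth E i)) /\
  forall i j c p, atlas c -> cdom c p ->
    inner h c p (tnth E i c p) (tnth E j c p) = (i == j)%:R.

Definition randers (h : chartG -> G -> 'M[R]_n) (X : chartG -> G -> V) :
    chartG -> G -> V -> R :=
  fun c p y => Num.sqrt (inner h c p y y) + inner h c p (X c p) y.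

Section Spray.
Variables (F : chartG -> G -> V -> R) (c : chartG).

Definition partial (f : V -> R) (i : 'I_n) (u : V) : R :=
  'D_(delta_mx 0 i) f u.

Definition Fsq (x y : V) : R := F c (cinv c x) y ^+ 2.

Definition fundamental_tensor (x y : V) : 'M[R]_n :=
  \matrix_(i, j) (2^-1 * partial (fun u => partial (Fsq x) j u) i y).

Definition spray (x y : V) : V :=
  \row_i (4^-1 * \sum_l invmx (fundamental_tensor x y) i l *
    (\sum_m partial (fun u => partial (fun z => Fsq z u) m x) l y * y 0 m
     - partial (fun z => Fsq z y) l x)).

End Spray.

Definition douglas_type (F : chartG -> G -> V -> R) : Prop :=
  forall c, atlas c ->
    exists (Gam : V -> 'I_n -> 'I_n -> 'I_n -> R) (P : V -> V -> R),
      (forall x y l, cimg c x -> y != 0 -> 0 < l ->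
         P x (l *: y) = l * P x y) /\
      (forall x y i, cimg c x -> y != 0 ->
         spray F c x y 0 i =
           2^-1 * (\sum_j \sum_k Gam x i j k * y 0 j * y 0 k)
           + P x y * y 0 i).

(* Constant speed geodesics: x'' + 2 G(x, x') = 0 in every chart. *)
Definition geodesic (F : chartG -> G -> V -> R) (gam : R -> G) : Prop :=
  forall t c, atlas c -> cdom c (gam t) ->
    let x := cmap c \o gam in
    [/\ \forall s \near t, derivable x s 1,
        derivable (derive1 x) t 1
      & derive1 (derive1 x) t = - 2 *: spray F c (x t) (derive1 x t)].

(* [gam] is t |-> exp (t Y): the one-parameter subgroup with velocity Y at the
   identity.  It is unique, and automatically smooth. *)
Definition one_parameter_subgroup (Y : chartG -> G -> V) (gam : R -> G) : Prop :=
  [/\ continuous gam,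
      forall s t, gam (s + t) = (gam s * gam t)%g
    & forall c, atlas c -> cdom c 1%g ->
        is_derive (0 : R) 1 (cmap c \o gam) (Y c 1%g)].

Definition geodesic_vector (F : chartG -> G -> V -> R)
    (Y : chartG -> G -> V) : Prop :=
  ~ vfield_eq Y 0 /\
  exists2 gam, one_parameter_subgroup Y gam & geodesic F gam.

End Fields.

(* Main.v *)
(** In coordinates [u] with respect to the left invariant orthonormal frame [E]
    the function [F^2] is the fixed function [Phi u = (|u| + <b, u>)^2], where
    [b] are the coordinates of [X].  Hence [F^2 (x, y) = Phi (y M(x))] with
    [M = E^-1], and since [dM = - M dE M] the spray [S] satisfies, for
    [y = u E(x)] and all [w],

      [Hess Phi_u ((2 S + u dE(y)) M, w) = - dPhi_u ([u, w])].

    As [Hess Phi_u] is nondegenerate and [t |-> exp (t u)] has acceleration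
    [u dE(y)], this curve is a geodesic iff [dPhi_u ([u, w]) = 0] for all [w].
    If [F] is of Douglas type then, modulo multiples of [u], the argument of the
    Hessian is even in [u]; comparing [u] with [- u] gives [<b, [u, w]> = 0], and
    the geodesic condition becomes [<u, [u, w]> = 0] for all [w].

    The one-parameter subgroup itself comes from Picard iteration in a chart at
    the identity: uniqueness turns the local solution [x] into a local
    homomorphism, which extends by [t |-> x (t / n) ^+ n]. *)

Require Import Defs.
From HB Require Import structures.
From mathcomp Require Import all_boot all_order all_algebra.
From mathcomp Require Import all_classical all_reals all_analysis.
From mathcomp Require Import ring lra.
Import Order.TTheory GRing.Theory Num.Theory numFieldNormedType.Exports.
Local Open Scope classical_set_scope.
Local Open Scope ring_scope.
Set Implicit Arguments.
Unset Strict Implicit.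
Unset Printing Implicit Defensive.

(** * Directional derivatives *)

(** The parity argument needs care, since the factor [P] of a Douglas spray is unknown and [F] has
    no parity. Testing the Hessian identity with [w = u] gives, by Euler's relation and [[u, u] =
    0], that the differential of [F] kills the first slot [T]. What is left of the Hessian is the
    angular form, and division by [2 F / |u|] yields [<T, w> - <u, T> <u, w> / |u|^2 = - <u, [u, w]>
    - |u| <b, [u, w]>]. The left side ignores multiples of [u], so [P] drops out, and [F] has been
    cancelled; only now can [u] be compared with [- u].

    In [l_{5,7}] the condition [<u, [u, w]> = 0] is tested on [w = E_1, ..., E_4]. The vector [E_1]
    gives minus the quadratic form of the theorem; the others give [y_1] times a triangular system
    in [y_3, y_4, y_5] with diagonal [a, d, g]. Hence [y_1 = 0] or [y_3 = y_4 = y_5 = 0].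

    All of this is done inside a chart, with the frame and its inverse as matrix functions on the
    open image of the chart; identities valid there may be differentiated. *)

Lemma is_derive_line (R : numFieldType) (V W : normedModType R) (f : V -> W) x v d :
  is_derive x v f d <-> is_derive (0 : R) 1 (fun h => f (h *: v + x)) d.
Proof.
have dE : 'D_v f x = 'D_1 (fun h : R => f (h *: v + x)) 0.
  rewrite /derive; set g1 := fun h => h^-1 *: _; set g2 := fun h => h^-1 *: _.
  suff -> : g1 = g2 by [].
  by apply/funext => h; rewrite /g1 /g2 /= addr0 scale0r add0r [_%:A]mulr1.
split=> -[df <-].
  by apply: DeriveDef; [exact: (derivable1P f x v).1|rewrite dE].
by apply: DeriveDef; [exact: (derivable1P f x v).2|rewrite dE].
Qed.

Lemma is_derive_mxP (R : realFieldType) (V : normedModType R) m n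
    (A : V -> 'M[R]_(m, n)) x v A' :
  is_derive x v A A' <-> forall i j, is_derive x v (fun z => A z i j) (A' i j).
Proof.
split=> [[dA <-] i j|dA].
  apply: DeriveDef; first exact: (derivable_mxP A x v).1.
  by rewrite derive_mx // mxE.
have dA1 : derivable A x v by apply/derivable_mxP => i j; case: (dA i j).
apply: DeriveDef => //; rewrite derive_mx //; apply/matrixP => i j.
by rewrite mxE derive_val.
Qed.

Lemma is_derive_mulmx (R : realFieldType) (V : normedModType R) m n p
    (A : V -> 'M[R]_(m, n)) (B : V -> 'M[R]_(n, p)) x v A' B' :
  is_derive x v A A' -> is_derive x v B B' ->
  is_derive x v (fun z => A z *m B z) (A' *m B x + A x *m B').
Proof.
move=> /is_derive_mxP dA /is_derive_mxP dB; apply/is_derive_mxP => i j.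
pose F (k : 'I_n) := (fun z => A z i k) * (fun z => B z k j).
have -> : (fun z => (A z *m B z) i j) = \sum_k F k.
  by apply/funext => z; rewrite mxE fct_sumE.
rewrite !mxE -big_split /=; apply: is_derive_sum => k.
apply: (is_derive_eq (is_deriveM (dA i k) (dB k j))).
by rewrite addrC; congr (_ + _); exact: mulrC.
Qed.

Lemma is_derive_addf (R : numFieldType) (V W : normedModType R)
    (f g : V -> W) x v f' g' :
  is_derive x v f f' -> is_derive x v g g' ->
  is_derive x v (fun z => f z + g z) (f' + g').
Proof. by move=> df dg; exact: is_deriveD. Qed.

Lemma is_derive_mulf (R : realFieldType) (V : normedModType R)
    (f g : V -> R) x v f' g' :
  is_derive x v f f' -> is_derive x v g g' ->
  is_derive x v (fun z => f z * g z) (f' * g x + f x * g').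
Proof.
move=> df dg; apply: (is_derive_eq (is_deriveM df dg)).
by rewrite addrC; congr (_ + _); exact: mulrC.
Qed.

Lemma is_derive_divf (R : realType) (V : normedModType R)
    (f g : V -> R) x v f' g' :
  is_derive x v f f' -> is_derive x v g g' -> g x != 0 ->
  is_derive x v (fun z => f z / g z) ((f' * g x - f x * g') / g x ^+ 2).
Proof.
move=> df dg g0.
have dV : is_derive x v (fun z => (g z)^-1) (- (g x ^- 2) * g').
  by case: dg => dg <-; apply: DeriveDef; [exact: derivableV|exact: deriveV].
apply: (is_derive_eq (is_derive_mulf df dV)); field; exact: g0.
Qed.

Lemma is_derive_trmx (R : realFieldType) (V : normedModType R) m n
    (A : V -> 'M[R]_(m, n)) x v A' :
  is_derive x v A A' -> is_derive x v (fun z => (A z)^T) A'^T.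
Proof.
move=> /is_derive_mxP dA; apply/is_derive_mxP => i j; rewrite mxE.
by under eq_fun do rewrite mxE.
Qed.

Lemma is_derive_sqrt_comp (R : realType) (V : normedModType R) (f : V -> R) x v d :
  is_derive x v f d -> 0 < f x ->
  is_derive x v (fun z => Num.sqrt (f z)) (d / (2 * Num.sqrt (f x))).
Proof.
move=> /is_derive_line df f0; apply/is_derive_line.
rewrite mulrC; apply: (@is_derive1_comp _ Num.sqrt).
by rewrite scale0r add0r; exact: is_derive1_sqrt.
Qed.

(** * The Euclidean scalar product of row vectors *)

Definition dotv (R : nzRingType) n (u v : 'rV[R]_n) : R := (u *m v^T) 0 0.

Section Dot.
Context {R : comNzRingType} {n : nat}.
Implicit Types (u v w : 'rV[R]_n) (k : R).

Lemma dotvE u v : dotv u v = \sum_i u 0 i * v 0 i.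
Proof. by rewrite /dotv mxE; apply: eq_bigr => i _; rewrite mxE. Qed.

Lemma dotvC u v : dotv u v = dotv v u.
Proof. by rewrite !dotvE; apply: eq_bigr => i _; rewrite mulrC. Qed.

Lemma dotvDl u v w : dotv (u + v) w = dotv u w + dotv v w.
Proof. by rewrite /dotv mulmxDl mxE. Qed.

Lemma dotvDr u v w : dotv w (u + v) = dotv w u + dotv w v.
Proof. by rewrite ![dotv w _]dotvC dotvDl. Qed.

Lemma dotvZl k u v : dotv (k *: u) v = k * dotv u v.
Proof. by rewrite /dotv -scalemxAl mxE. Qed.

Lemma dotvZr k u v : dotv u (k *: v) = k * dotv u v.
Proof. by rewrite dotvC dotvZl dotvC. Qed.

Lemma dotvNl u v : dotv (- u) v = - dotv u v.
Proof. by rewrite -scaleN1r dotvZl mulN1r. Qed.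

Lemma dotvNr u v : dotv u (- v) = - dotv u v.
Proof. by rewrite dotvC dotvNl dotvC. Qed.

Lemma dotvBl u v w : dotv (u - v) w = dotv u w - dotv v w.
Proof. by rewrite dotvDl dotvNl. Qed.

Lemma dot0v u : dotv 0 u = 0.
Proof. by rewrite /dotv mul0mx mxE. Qed.

Lemma dotv0 u : dotv u 0 = 0.
Proof. by rewrite dotvC dot0v. Qed.

Lemma dotv_delta u i : dotv u (delta_mx 0 i) = u 0 i.
Proof. by rewrite /dotv trmx_delta -colE mxE. Qed.

Lemma dotv_eq u v : (forall w, dotv u w = dotv v w) -> u = v.
Proof.
by move=> uv; apply/rowP => i; rewrite -!dotv_delta uv.
Qed.
End Dot.

Lemma is_derive_dotv (R : realFieldType) (V : normedModType R) n
    (f g : V -> 'rV[R]_n) x v f' g' :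
  is_derive x v f f' -> is_derive x v g g' ->
  is_derive x v (fun z => dotv (f z) (g z)) (dotv f' (g x) + dotv (f x) g').
Proof.
move=> df dg.
have /is_derive_mxP/(_ 0 0) := is_derive_mulmx df (is_derive_trmx dg).
by rewrite mxE.
Qed.

(* Locked because unification otherwise unfolds ['d], at great cost. *)
HB.lock Definition dder (R : numDomainType) (V W : normedModType R) (f : V -> W)
  (x v : V) : W :=
  'd f x v.

Lemma dderE (R : numDomainType) (V W : normedModType R) (f : V -> W) x v :
  'd f x v = dder f x v.
Proof. by rewrite dder.unlock. Qed.

Lemma dder_linear (R : numDomainType) (V W : normedModType R) (f : V -> W) x k u v :
  dder f x (k *: u + v) = k *: dder f x u + dder f x v.
Proof. by rewrite dder.unlock linearP. Qed.

Lemma dder0 (R : numDomainType) (V W : normedModType R) (f : V -> W) x : dder f x 0 = 0.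
Proof. by rewrite dder.unlock linear0. Qed.

Lemma dderN (R : numDomainType) (V W : normedModType R) (f : V -> W) x v :
  dder f x (- v) = - dder f x v.
Proof. by rewrite dder.unlock linearN. Qed.

Lemma is_derive_dder (R : numFieldType) (V W : normedModType R) (f : V -> W) x v :
  differentiable f x -> is_derive x v f (dder f x v).
Proof.
by move=> df; rewrite -dderE; apply: DeriveDef; [exact: diff_derivable|exact: deriveE].
Qed.

Lemma is_derive_diff_comp (R : numFieldType) (V W : normedModType R)
    (f : V -> W) (p : R -> V) (t : R) p' :
  is_derive t 1 p p' -> differentiable f (p t) ->
  is_derive t 1 (f \o p) (dder f (p t) p').
Proof.
move=> [dp <-] df; have dp' : differentiable p t by exact/derivable1_diffP.
have dfp : differentiable (f \o p) t by exact: differentiable_comp.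
apply: DeriveDef; first exact/derivable1_diffP.
by rewrite deriveE // diff_comp //= -dderE deriveE.
Qed.

Lemma is_derive_scalel (R : numFieldType) (V : normedModType R) (s : R) (v : V) :
  is_derive s 1 (fun t : R => t *: v) v.
Proof.
apply: DeriveDef; first exact/derivable1_diffP.
by rewrite deriveE // diff_val scale1r.
Qed.

(** * Randers norms *)

Section Randers.
Context {R : realType} {n : nat}.
Implicit Types (b u v w : 'rV[R]_n).

Definition enorm u : R := Num.sqrt (dotv u u).
Definition randersF b u : R := enorm u + dotv b u.
(** The differential of [randersF b] at [u <> 0]; accordingly [dFsq] is the differential of its
    square. *)
Definition dranders b u w : R := dotv u w / enorm u + dotv b w.
Definition dFsq b u w : R := 2 * randersF b u * dranders b u w.
(** The second differential of [F^2], twice the fundamental tensor. The linear part of [F] has no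
    second derivative, so the second summand only involves the Hessian of the Euclidean norm. *)
Definition hessFsq b u v w : R :=
  2 * dranders b u v * dranders b u w
  + 2 * randersF b u / enorm u * (dotv v w - dotv u v * dotv u w / dotv u u).

Lemma dotvv_ge0 u : 0 <= dotv u u.
Proof. by rewrite dotvE sumr_ge0 // => i _; rewrite -expr2 sqr_ge0. Qed.

Lemma dotvv_eq0 u : (dotv u u == 0) = (u == 0).
Proof.
apply/eqP/eqP => [|->]; last by rewrite dot0v.
rewrite dotvE => /eqP; rewrite psumr_eq0; last by move=> i _; rewrite -expr2 sqr_ge0.
move=> /allP u0; apply/rowP => i; rewrite mxE.
by apply/eqP; have := u0 i (mem_index_enum i); rewrite mulf_eq0 orbb.
Qed.

Lemma dotvv_gt0 u : u != 0 -> 0 < dotv u u.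
Proof. by move=> u0; rewrite lt_def dotvv_eq0 u0 dotvv_ge0. Qed.

Lemma enorm_gt0 u : u != 0 -> 0 < enorm u.
Proof. by move=> u0; rewrite sqrtr_gt0 dotvv_gt0. Qed.

Lemma sqr_enorm u : enorm u ^+ 2 = dotv u u.
Proof. by rewrite sqr_sqrtr // dotvv_ge0. Qed.

Lemma randersF_neq0 b u : dotv b b < 1 -> u != 0 -> randersF b u != 0.
Proof.
move=> b1 u0; apply/eqP => F0.
have u_gt0 := dotvv_gt0 u0.
have bu : dotv b u = - enorm u by move: F0; rewrite /randersF => ?; lra.
(* Cauchy-Schwarz: this vector is [|u|^2] times the part of [b] orthogonal to [u]. With
   [<b, u> = - |u|] its squared length would be [|u|^4 (|b|^2 - 1) < 0]. *)
have := dotvv_ge0 (dotv u u *: b - dotv b u *: u).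
rewrite !(dotvBl, dotvDr, dotvNr, dotvZl, dotvZr) (dotvC u b) bu.
rewrite (_ : _ - _ - _ = dotv u u * dotv u u * (dotv b b - 1)); last first.
  by rewrite -sqr_enorm; ring.
by rewrite leNgt pmulr_rlt0 ?mulr_gt0 // subr_lt0 b1.
Qed.

(** Stated for a composite with [g], so that one rule serves both the derivatives in [y], where [g]
    is linear, and those in the position, where [g z = u M(z)]. *)
Lemma is_derive_Fsq (V : normedModType R) b (g : V -> 'rV[R]_n) (p q : V) g' :
  is_derive p q g g' -> g p != 0 ->
  is_derive p q (fun z => randersF b (g z) ^+ 2) (dFsq b (g p) g').
Proof.
move=> dg gx; have g0 := dotvv_gt0 gx; have e0 := enorm_gt0 gx.
have dN := is_derive_sqrt_comp (is_derive_dotv dg dg) g0.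
have dB := is_derive_dotv (is_derive_cst b p q) dg.
have dF := is_derive_addf dN dB.
apply: (is_derive_eq (is_derive_mulf dF dF)); rewrite dot0v add0r /cst.
rewrite -/(enorm (g p)) -/(randersF b (g p)) /dFsq /dranders (dotvC g').
by field; rewrite gt_eqF.
Qed.

(** Base point and direction move together, as they do in the mixed derivatives in [x] and [y] of
    the spray coefficients. *)
Lemma is_derive_dFsq (V : normedModType R) b (g h : V -> 'rV[R]_n) (p q : V) g' h' :
  is_derive p q g g' -> is_derive p q h h' -> g p != 0 ->
  is_derive p q (fun z => dFsq b (g z) (h z))
    (hessFsq b (g p) g' (h p) + dFsq b (g p) h').
Proof.
move=> dg dh gx; have g0 := dotvv_gt0 gx; have e0 := enorm_gt0 gx.
have dN := is_derive_sqrt_comp (is_derive_dotv dg dg) g0.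
have dB := is_derive_dotv (is_derive_cst b p q) dg.
have dC := is_derive_dotv (is_derive_cst b p q) dh.
have dF := is_derive_addf dN dB.
have dQ := is_derive_addf (is_derive_divf (is_derive_dotv dg dh) dN (lt0r_neq0 e0)) dC.
have dT := is_derive_mulf (is_derive_mulf (is_derive_cst (2 : R) p q) dF) dQ.
apply: (is_derive_eq dT); rewrite !dot0v !add0r mul0r add0r /cst.
rewrite -/(enorm (g p)) -/(randersF b (g p)) /dFsq /hessFsq /dranders (dotvC g').
by rewrite -sqr_enorm; field; rewrite gt_eqF.
Qed.

Lemma dranders_linear b u k v w :
  dranders b u (k *: v + w) = k * dranders b u v + dranders b u w.
Proof. by rewrite /dranders !dotvDr !dotvZr; ring. Qed.

Lemma dFsq_linear b u k v w :
  dFsq b u (k *: v + w) = k * dFsq b u v + dFsq b u w.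
Proof. by rewrite /dFsq dranders_linear; ring. Qed.

Lemma hessFsqC b u v w : hessFsq b u v w = hessFsq b u w v.
Proof. by rewrite /hessFsq (dotvC v w); ring. Qed.

Lemma hessFsq_linear b u k v v' w :
  hessFsq b u (k *: v + v') w = k * hessFsq b u v w + hessFsq b u v' w.
Proof. by rewrite /hessFsq dranders_linear dotvDl dotvDr dotvZl dotvZr; ring. Qed.

Lemma dFsqN b u v : dFsq b u (- v) = - dFsq b u v.
Proof. by rewrite /dFsq /dranders !dotvNr; ring. Qed.

Lemma hessFsqN b u v w : hessFsq b u (- v) w = - hessFsq b u v w.
Proof. by rewrite /hessFsq /dranders dotvNl !dotvNr; ring. Qed.

Lemma dranders_self b u : u != 0 -> dranders b u u = randersF b u.
Proof.
move=> u0; rewrite /dranders -sqr_enorm /randersF; field.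
by rewrite gt_eqF ?enorm_gt0.
Qed.

(* Euler's relation for the 2-homogeneous function F^2. *)
Lemma hessFsq_self b u v : u != 0 -> hessFsq b u v u = dFsq b u v.
Proof.
move=> u0; rewrite /hessFsq dranders_self // (dotvC v u) /dFsq.
by rewrite mulfK ?subrr ?mulr0 ?addr0; [ring|rewrite gt_eqF ?dotvv_gt0].
Qed.

(** Euler's relation at [w = u] gives [dF(v) = 0] because [F <> 0]. The angular part then forces
    [v = k u], and [0 = dF(v) = k F] gives [k = 0]. *)
Lemma hessFsq_nondeg b u v : dotv b b < 1 -> u != 0 ->
  (forall w, hessFsq b u v w = 0) -> v = 0.
Proof.
move=> b1 u0 Hv; have F0 := randersF_neq0 b1 u0.
have e0 : enorm u != 0 by rewrite gt_eqF ?enorm_gt0.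
have dv0 : dranders b u v = 0.
  have := Hv u; rewrite hessFsq_self // /dFsq => /eqP.
  by rewrite !mulf_eq0 pnatr_eq0 (negPf F0) /= => /eqP.
have vE : v = (dotv u v / dotv u u) *: u.
  apply: dotv_eq => w; rewrite dotvZl; apply/eqP; rewrite -subr_eq0.
  have := Hv w; rewrite /hessFsq dv0 mulr0 mul0r add0r => /eqP.
  rewrite !mulf_eq0 pnatr_eq0 invr_eq0 (negPf F0) (negPf e0) /=.
  by rewrite mulrAC.
have := dv0; rewrite vE -[_ *: u]addr0 dranders_linear dranders_self //.
rewrite (_ : dranders b u 0 = 0) ?addr0; last by rewrite /dranders !dotv0 mul0r addr0.
move=> /eqP; rewrite mulf_eq0 (negPf F0) orbF => /eqP c0.
by rewrite c0 scale0r.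
Qed.
End Randers.

(** * The spray in a frame *)

(** Linearity is a bare equation, so that the lemma applies to the slots of [hessFsq] and [dFsq] as
    they stand. *)
Lemma linear_row_sum (R : comNzRingType) n (f : 'rV[R]_n -> R) :
  (forall k v w, f (k *: v + w) = k * f v + f w) ->
  forall v, f v = \sum_i v 0 i * f (delta_mx 0 i).
Proof.
move=> fl v.
have f0 : f 0 = 0.
  have /eqP := fl 1 0 0; rewrite scaler0 addr0 mul1r.
  by rewrite -subr_eq0 opprD addrA subrr sub0r oppr_eq0 => /eqP.
rewrite {1}(row_sum_delta v) (big_morph f (id1 := 0) (op1 := +%R)) //.
  by apply: eq_bigr => i _; rewrite -[_ *: _]addr0 fl f0 addr0.
by move=> x y; rewrite -[x in LHS]scale1r fl mul1r.
Qed.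

Lemma near_neq0 (R : realFieldType) n (y : 'rV[R]_n) : y != 0 ->
  \forall u \near y, u != 0.
Proof. by move=> y0; apply: (@cvgr_neq0 _ _ _ (nbhs y) _ id y) => //; exact: cvg_id. Qed.

Lemma is_derive_mulmxr (R : realFieldType) n p (A : 'M[R]_(n, p)) (y v : 'rV[R]_n) :
  is_derive y v (fun u => u *m A) (v *m A).
Proof.
apply: (is_derive_eq (is_derive_mulmx (is_derive_id y v) (is_derive_cst A y v))).
by rewrite mulmx0 addr0.
Qed.

Lemma is_derive_mulmxl (R : realFieldType) (V : normedModType R) m n p
    (u : 'M[R]_(m, n)) (A : V -> 'M[R]_(n, p)) (z v : V) :
  differentiable A z -> is_derive z v (fun z => u *m A z) (u *m dder A z v).
Proof.
move=> dA.
apply: (is_derive_eq (is_derive_mulmx (is_derive_cst u z v) (is_derive_dder v dA))).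
by rewrite mul0mx add0r.
Qed.

Section SprayInFrame.
Context {R : realType} {n : nat} {G : lieGroupType R n}.
Variables (F : chart R n G -> G -> 'rV[R]_n -> R) (c : chart R n G).
Variables (b : 'rV[R]_n) (M : 'rV[R]_n -> 'M[R]_n).
Hypothesis FM : forall z y, cimg c z -> F c (cinv c z) y = randersF b (y *m M z).
Hypothesis b1 : dotv b b < 1.
Hypothesis M_unit : forall z, cimg c z -> M z \in unitmx.
Hypothesis dM : forall z, cimg c z -> differentiable M z.
Implicit Types (x y z u v w : 'rV[R]_n) (i j l m : 'I_n).

Lemma near_cimg z : cimg c z -> \forall z' \near z, cimg c z'.
Proof. by move=> cz; apply: open_nbhs_nbhs; split => //; exact: cimg_open. Qed.

Lemma frame_neq0 z u : cimg c z -> u != 0 -> u *m M z != 0.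
Proof.
move=> cz; apply: contra_neq => uM.
by rewrite -[u](mulmxK (M_unit cz)) uM mul0mx.
Qed.

Lemma partial_FsqE x u j : cimg c x -> u != 0 ->
  partial (Fsq F c x) j u = dFsq b (u *m M x) (delta_mx 0 j *m M x).
Proof.
move=> cx u0; rewrite /partial.
have -> : Fsq F c x = fun y => randersF b (y *m M x) ^+ 2.
  by apply/funext => y; rewrite /Fsq FM.
apply: derive_val; apply: is_derive_Fsq; last exact: frame_neq0.
exact: is_derive_mulmxr.
Qed.

Lemma fundamental_tensorE x y i j : cimg c x -> y != 0 ->
  fundamental_tensor F c x y i j
  = 2^-1 * hessFsq b (y *m M x) (delta_mx 0 i *m M x) (delta_mx 0 j *m M x).
Proof.
move=> cx y0; rewrite mxE; congr (_ * _); rewrite /partial.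
(* The formula for the inner derivative holds only away from the zero vector, where the norm is
   smooth; near [y <> 0] this is enough. *)
rewrite (@near_eq_derive _ _ _ _ (fun u => dFsq b (u *m M x) (delta_mx 0 j *m M x))).
  apply: derive_val.
  have dy := is_derive_mulmxr (M x) y (delta_mx 0 i).
  have de := is_derive_cst (delta_mx 0 j *m M x : 'rV__) y (delta_mx 0 i).
  apply: (is_derive_eq (is_derive_dFsq b dy de (frame_neq0 cx y0))).
  by rewrite /dFsq /dranders !dotv0 mul0r addr0 mulr0 addr0.
by near=> u; apply: partial_FsqE => //; near: u; exact: near_neq0.
Unshelve. all: by end_near. Qed.

Lemma partial_x_FsqE x u m : cimg c x -> u != 0 ->
  partial (fun z => Fsq F c z u) m x = dFsq b (u *m M x) (u *m dder M x (delta_mx 0 m)).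
Proof.
move=> cx u0; rewrite /partial.
(* The frame expression of [F] is available only on the image of the chart, a neighbourhood of
   [x]. *)
rewrite (@near_eq_derive _ _ _ _ (fun z => randersF b (u *m M z) ^+ 2)).
  apply: derive_val; apply: is_derive_Fsq; last exact: frame_neq0.
  exact/is_derive_mulmxl/dM.
by near=> z; rewrite /Fsq FM //; near: z; exact: near_cimg.
Unshelve. all: by end_near. Qed.

Lemma partial_xy_FsqE x y m l : cimg c x -> y != 0 ->
  partial (fun u => partial (fun z => Fsq F c z u) m x) l y
  = hessFsq b (y *m M x) (delta_mx 0 l *m M x) (y *m dder M x (delta_mx 0 m))
    + dFsq b (y *m M x) (delta_mx 0 l *m dder M x (delta_mx 0 m)).
Proof.
move=> cx y0; rewrite {1}/partial; set D := dder M x (delta_mx 0 m).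
rewrite (@near_eq_derive _ _ _ _ (fun u => dFsq b (u *m M x) (u *m D))).
  apply: derive_val.
  have dy := is_derive_mulmxr _ y (delta_mx 0 l).
  exact: (is_derive_dFsq b (dy _ _) (dy _ _) (frame_neq0 cx y0)).
by near=> u; apply: partial_x_FsqE => //; near: u; exact: near_neq0.
Unshelve. all: by end_near. Qed.

Lemma fundamental_tensor_form x y v w : cimg c x -> y != 0 ->
  dotv (v *m fundamental_tensor F c x y) w
  = 2^-1 * hessFsq b (y *m M x) (v *m M x) (w *m M x).
Proof.
move=> cx y0; pose H v w := hessFsq b (y *m M x) (v *m M x) (w *m M x).
have Hl w' k v1 v2 : H (k *: v1 + v2) w' = k * H v1 w' + H v2 w'.
  by rewrite /H mulmxDl -scalemxAl hessFsq_linear.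
have Hr v' k v1 v2 : H v' (k *: v1 + v2) = k * H v' v1 + H v' v2.
  by rewrite /H ![hessFsq b _ (v' *m _) _]hessFsqC; exact: Hl.
rewrite -/(H v w) (linear_row_sum (Hr v)) mulr_sumr dotvE.
apply: eq_bigr => l _; rewrite (linear_row_sum (Hl _)) mxE mulrCA mulrC.
congr (_ * _); rewrite mulr_sumr; apply: eq_bigr => i _.
by rewrite fundamental_tensorE // mulrCA.
Qed.

Lemma fundamental_tensor_unit x y : cimg c x -> y != 0 ->
  fundamental_tensor F c x y \in unitmx.
Proof.
move=> cx y0; rewrite -row_free_unit; apply: inj_row_free => v vg.
have vM : v *m M x = 0.
  apply: (hessFsq_nondeg b1 (frame_neq0 cx y0)) => w.
  have := fundamental_tensor_form v (w *m invmx (M x)) cx y0.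
  rewrite vg dot0v mulmxKV ?M_unit // => /esym/eqP.
  by rewrite mulf_eq0 invr_eq0 pnatr_eq0 => /eqP.
by rewrite -[v](mulmxK (M_unit cx)) vM mul0mx.
Qed.

(** Contracting with the fundamental tensor [g] removes its inverse: [4 g(S, w)] is the mixed
    derivative of [F^2] in [x] along [y] and in [y] along [w], minus the derivative in [x] along
    [w]. As [g] is half the Hessian, the factor 4 becomes 2. *)
Lemma spray_frame x y w : cimg c x -> y != 0 ->
  2 * hessFsq b (y *m M x) (spray F c x y *m M x) (w *m M x)
  = hessFsq b (y *m M x) (y *m dder M x y) (w *m M x)
    + dFsq b (y *m M x) (w *m dder M x y) - dFsq b (y *m M x) (y *m dder M x w).
Proof.
move=> cx y0; set g := fundamental_tensor F c x y.
(* Symmetry turns the sum over the second index of the inverse into multiplication of a row from the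
   right. *)
have gT : g^T = g.
  by apply/matrixP => i j; rewrite mxE !fundamental_tensorE // hessFsqC.
pose D v := dder M x v; pose u := y *m M x.
pose rhs l := \sum_m partial (fun u => partial (fun z => Fsq F c z u) m x) l y * y 0 m
     - partial (fun z => Fsq F c z y) l x.
have Sg : spray F c x y *m g = 4^-1 *: \row_l rhs l.
  have -> : spray F c x y = 4^-1 *: ((\row_l rhs l) *m invmx g).
    apply/rowP => i; rewrite !mxE; congr (_ * _); apply: eq_bigr => l _.
    by rewrite [in RHS]mxE mulrC -[in RHS]gT -trmx_inv [in RHS]mxE.
  by rewrite -scalemxAl mulmxKV // fundamental_tensor_unit.
have := fundamental_tensor_form (spray F c x y) w cx y0.
rewrite -/g Sg dotvZl => /(congr1 ( *%R 4)); rewrite mulrA divff ?pnatr_eq0 // mul1r.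
move=> /esym; rewrite mulrA (_ : 4 / 2 = 2 :> R); last by field.
move=> ->; pose f w := hessFsq b u (w *m M x) (y *m D y)
  + dFsq b u (w *m D y) - dFsq b u (y *m D w).
have fl k v1 v2 : f (k *: v1 + v2) = k * f v1 + f v2.
  rewrite /f /D dder_linear mulmxDr -scalemxAr !mulmxDl -!scalemxAl.
  by rewrite !dFsq_linear hessFsq_linear; ring.
rewrite -/u -/(D y) -/(D w) (hessFsqC _ _ (y *m D y)) -/(f w) (linear_row_sum fl) dotvE.
apply: eq_bigr => l _; rewrite mxE mulrC; congr (_ * _); rewrite /rhs /f.
rewrite partial_x_FsqE //; congr (_ - _).
(* The mixed derivative with the position direction [v] left free; its linearity in [v] resums the
   terms [y 0 m]. *)
pose q v := hessFsq b u (delta_mx 0 l *m M x) (y *m D v) + dFsq b u (delta_mx 0 l *m D v).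
have ql k v1 v2 : q (k *: v1 + v2) = k * q v1 + q v2.
  rewrite /q /D dder_linear !mulmxDr -!scalemxAr dFsq_linear.
  by rewrite !(hessFsqC b u (delta_mx 0 l *m M x)) hessFsq_linear; ring.
rewrite -/(q y) (linear_row_sum ql); apply: eq_bigr => m _.
by rewrite partial_xy_FsqE // mulrC.
Qed.
End SprayInFrame.

(** Here [T] stands for the defect of the geodesic equation in frame coordinates and [B] for the
    bracket with [u]. Replacing [T] by [T + k u] does not affect the left side of the conclusion. *)
Lemma hessFsq_solve (R : realType) n (b u T : 'rV[R]_n) (B : 'rV[R]_n -> 'rV[R]_n) :
  dotv b b < 1 -> u != 0 -> B u = 0 ->
  (forall w, hessFsq b u T w = - dFsq b u (B w)) ->
  forall w, dotv T w - dotv u T * dotv u w / dotv u u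
            = - dotv u (B w) - enorm u * dotv b (B w).
Proof.
move=> b1 u0 Bu HT w; have F0 := randersF_neq0 b1 u0.
have e0 : enorm u != 0 by rewrite gt_eqF ?enorm_gt0.
have T0 : dranders b u T = 0.
  have := HT u; rewrite Bu hessFsq_self // /dFsq.
  rewrite [dranders b u 0]/dranders !dotv0 mul0r addr0 mulr0 oppr0 => /eqP.
  by rewrite !mulf_eq0 pnatr_eq0 (negPf F0) => /eqP.
apply: (mulfI (mulf_neq0 F0 (invr_neq0 e0))).
have := HT w; rewrite /hessFsq T0 mulr0 mul0r add0r /dFsq => HTw.
apply: (@mulfI _ 2); first by rewrite pnatr_eq0.
rewrite !mulrA HTw /dranders; field; exact: e0.
Qed.

Lemma differentiable_mx (R : realFieldType) (V : normedModType R) m n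
    (A : V -> 'M[R]_(m, n)) (x : V) :
  (forall i j, differentiable (fun z => A z i j) x) -> differentiable A x.
Proof.
move=> dA; pose D (k : 'I_m * 'I_n) : V -> 'M[R]_(m, n) :=
  fun z => A z k.1 k.2 *: delta_mx k.1 k.2.
have -> : A = \sum_k D k.
  apply/funext => z; rewrite fct_sumE [LHS]matrix_sum_delta pair_big.
  by apply: eq_bigr => -[].
rewrite big_enum_val /=; apply: differentiable_sum => i.
exact/differentiableZl/dA.
Qed.

Lemma differentiable_entry (R : realFieldType) (V : normedModType R) m n
    (A : V -> 'M[R]_(m, n)) (x : V) i j :
  differentiable A x -> differentiable (fun z => A z i j) x.
Proof.
move=> dA; apply: (@differentiable_comp _ _ _ _ A (fun N : 'M[R]_(m, n) => N i j)) => //.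
exact: differentiable_coord.
Qed.

Lemma differentiable_mulmx (R : realFieldType) (V : normedModType R) m n p
    (A : V -> 'M[R]_(m, n)) (B : V -> 'M[R]_(n, p)) (x : V) :
  differentiable A x -> differentiable B x ->
  differentiable (fun z => A z *m B z) x.
Proof.
move=> dA dB; apply: differentiable_mx => i j.
pose F (k : 'I_n) := (fun z => A z i k) * (fun z => B z k j).
have -> : (fun z => (A z *m B z) i j) = \sum_k F k.
  by apply/funext => z; rewrite mxE fct_sumE.
apply: differentiable_sum => k.
by apply: differentiableM; exact: differentiable_entry.
Qed.

(** * Left invariant orthonormal frames and the Douglas condition *)

Section Frame.
Context {R : realType} {n : nat} {G : lieGroupType R n}.
Variables (h : chart R n G -> G -> 'M[R]_n).
Variable E : n.-tuple (chart R n G -> G -> 'rV[R]_n).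
Hypothesis hh : left_invariant_metric h.
Hypothesis hE : orthonormal_basis h E.
Implicit Types (c : chart R n G) (p q : G) (x y z u v w : 'rV[R]_n).
Implicit Types (A B X Y : chart R n G -> G -> 'rV[R]_n).

Lemma cinv_cdom c z : cimg c z -> cdom c (cinv c z).
Proof. by move=> [p cp <-]; rewrite cmapK // inE. Qed.

Lemma cinvK c z : cimg c z -> cmap c (cinv c z) = z.
Proof. by move=> [p cp <-]; rewrite cmapK // inE. Qed.

Lemma cimg_cmap c p : cdom c p -> cimg c (cmap c p).
Proof. by move=> cp; exists p. Qed.

Lemma inner_left_invariant A B : left_invariant_vfield A -> left_invariant_vfield B ->
  forall c c' p p', atlas c -> atlas c' -> cdom c p -> cdom c' p' ->
  inner h c p (A c p) (B c p) = inner h c' p' (A c' p') (B c' p').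
Proof.
move=> [_ lA] [_ lB] c c' p p' ac ac' cp cp'.
have -> : p' = ((p' * p^-1) * p)%g by rewrite mulgVK.
have cq : cdom c' (p' * p^-1 * p)%g by rewrite mulgVK.
by rewrite (lA _ _ _ _ ac ac' cp cq) (lB _ _ _ _ ac ac' cp cq) hh.2.
Qed.

Definition frame_mx c z : 'M[R]_n := \matrix_(i, j) tnth E i c (cinv c z) 0 j.
(** The inverse of the frame matrix: orthonormality reads [E h E^T = 1]. This closed form makes its
    differentiability a consequence of that of [h] and [E]. *)
Definition coframe_mx c z : 'M[R]_n := h c (cinv c z) *m (frame_mx c z)^T.

Lemma frame_coframe c z : atlas c -> cimg c z ->
  frame_mx c z *m coframe_mx c z = 1%:M.
Proof.
move=> ac cz; apply/matrixP => i j; rewrite mulmxA !mxE.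
rewrite -(hE.2 i j c (cinv c z) ac (cinv_cdom cz)) /inner mxE.
have rE k : tnth E k c (cinv c z) = row k (frame_mx c z).
  by apply/rowP => l; rewrite !mxE.
rewrite !rE; apply: eq_bigr => k _; congr (_ * _); last by rewrite !mxE.
by rewrite -row_mul [RHS]mxE.
Qed.

Lemma coframe_frame c z : atlas c -> cimg c z ->
  coframe_mx c z *m frame_mx c z = 1%:M.
Proof. by move=> ac cz; apply: mulmx1C; exact: frame_coframe. Qed.

Lemma coframe_unit c z : atlas c -> cimg c z -> coframe_mx c z \in unitmx.
Proof. by move=> ac cz; case/mulmx1_unit: (frame_coframe ac cz). Qed.

Lemma frame_metric c z u v : atlas c -> cimg c z ->
  inner h c (cinv c z) (u *m frame_mx c z) (v *m frame_mx c z) = dotv u v.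
Proof.
move=> ac cz; have := frame_coframe ac cz; rewrite /coframe_mx mulmxA => EhE.
by rewrite /inner trmx_mul -!mulmxA (mulmxA (h _ _)) (mulmxA (frame_mx _ _)) mulmxA
  [_ *m (_ *m _^T)]mulmxA EhE mulmx1.
Qed.

Lemma frame_differentiable c z : atlas c -> cimg c z ->
  differentiable (frame_mx c) z.
Proof.
move=> ac cz; apply: differentiable_mx => i j.
under eq_fun do rewrite mxE; apply: differentiable_entry.
by have [[_ /(_ c ac 1%N) [sE _]] _] := hE.1 i; exact: sE.
Qed.

Lemma coframe_differentiable c z : atlas c -> cimg c z ->
  differentiable (coframe_mx c) z.
Proof.
move=> ac cz; apply: differentiable_mulmx.
  by have [[_ _ _ /(_ c ac 1%N) [sh _]] _] := hh; exact: sh.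
apply: differentiable_mx => i j; under eq_fun do rewrite mxE.
exact/differentiable_entry/frame_differentiable.
Qed.

Lemma diff_coframe c z v : atlas c -> cimg c z ->
  dder (coframe_mx c) z v
  = - (coframe_mx c z *m dder (frame_mx c) z v *m coframe_mx c z).
Proof.
move=> ac cz; have dE := frame_differentiable ac cz.
have dM := coframe_differentiable ac cz.
have /@derive_val := is_derive_mulmx (is_derive_dder v dE) (is_derive_dder v dM).
(* The product is known to be the identity only on the image of the chart, which is open. *)
rewrite (@near_eq_derive _ _ _ _ (cst 1%:M)); last first.
  by near=> y; apply: frame_coframe => //; near: y; exact: near_cimg.
rewrite derive_cst => /esym/eqP; rewrite addrC addr_eq0 => /eqP.
move=> /(congr1 (mulmx (coframe_mx c z))).
by rewrite mulmxA coframe_frame // mul1mx mulmxN mulmxA.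
Unshelve. all: by end_near. Qed.

(* Coordinates in the frame [E] of the bracket of [u *m E] and [w *m E]. *)
Definition frame_bracket c x u w : 'rV[R]_n :=
  (w *m dder (frame_mx c) x (u *m frame_mx c x)
   - u *m dder (frame_mx c) x (w *m frame_mx c x)) *m coframe_mx c x.

Lemma frame_bracket_linearr c x u k v w :
  frame_bracket c x u (k *: v + w) = k *: frame_bracket c x u v + frame_bracket c x u w.
Proof.
rewrite /frame_bracket scalemxAl -mulmxDl; congr (_ *m _).
rewrite (mulmxDl _ _ (frame_mx c x)) -scalemxAl dder_linear mulmxDl mulmxDr.
by rewrite -scalemxAl -scalemxAr scalerBr opprD addrACA.
Qed.

Lemma frame_bracketC c x u w : frame_bracket c x u w = - frame_bracket c x w u.
Proof. by rewrite /frame_bracket -[in LHS]opprB mulNmx. Qed.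

Lemma frame_bracket_self c x u : frame_bracket c x u u = 0.
Proof. by rewrite /frame_bracket subrr mul0mx. Qed.

Lemma frame_bracket0r c x u : frame_bracket c x u 0 = 0.
Proof. by rewrite /frame_bracket !mul0mx dder0 mulmx0 subrr mul0mx. Qed.

Lemma frame_bracketN c x u w : frame_bracket c x (- u) w = - frame_bracket c x u w.
Proof. by rewrite ![frame_bracket _ _ _ w]frame_bracketC -(scaleN1r u) -[_ *: u]addr0
  frame_bracket_linearr frame_bracket0r addr0 scaleN1r. Qed.

(** The coordinates are the inner products with the fields [E_i]. Left translations preserve the
    metric and both fields, so these numbers depend neither on the point nor on the chart and can be
    read at the identity. *)
Lemma left_invariant_coord X : left_invariant_vfield X ->
  exists b, forall c p, atlas c -> cdom c p -> X c p = b *m frame_mx c (cmap c p).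
Proof.
move=> lX; have [c1 ac1 c1p] := @atlas_cover R n G 1%g.
exists (\row_i inner h c1 1%g (X c1 1%g) (tnth E i c1 1%g)) => c p ac cp.
have cz := cimg_cmap cp; have pK : cinv c (cmap c p) = p by rewrite cmapK ?inE.
rewrite -[X c p]mulmx1 -(coframe_frame ac cz) mulmxA; congr (_ *m _).
apply/rowP => i; rewrite [in RHS]mxE.
rewrite (inner_left_invariant lX (hE.1 i) ac1 ac c1p cp) /inner /coframe_mx pK mulmxA.
by rewrite !mxE; apply: eq_bigr => j _; rewrite !mxE pK.
Qed.

Variables (X : chart R n G -> G -> 'rV[R]_n) (b : 'rV[R]_n).
Hypothesis bE : forall c p, atlas c -> cdom c p -> X c p = b *m frame_mx c (cmap c p).
Hypothesis X1 : forall c p, atlas c -> cdom c p ->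
  Num.sqrt (inner h c p (X c p) (X c p)) < 1.

Lemma randers_frame c z y : atlas c -> cimg c z ->
  randers h X c (cinv c z) y = randersF b (y *m coframe_mx c z).
Proof.
move=> ac cz; have yE : y = (y *m coframe_mx c z) *m frame_mx c z.
  by rewrite -mulmxA coframe_frame // mulmx1.
rewrite /randers bE //; last exact: cinv_cdom.
by rewrite cinvK // {1 2 3}yE !frame_metric.
Qed.

Lemma sqr_coord_lt1 : dotv b b < 1.
Proof.
have [c1 ac1 c1p] := @atlas_cover R n G 1%g.
have cz := cimg_cmap c1p; have pK : cinv c1 (cmap c1 1%g) = 1%g by rewrite cmapK ?inE.
have := X1 ac1 c1p; rewrite bE // -{1}pK frame_metric // -[X in _ < X]sqrtr1.
by rewrite ltr_sqrt.
Qed.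

(* The vector in the first slot vanishes iff [t |-> exp (t u)] satisfies the
   geodesic equation. *)
Lemma spray_geodesic_defect c x u w : atlas c -> cimg c x -> u != 0 ->
  let y := u *m frame_mx c x in
  hessFsq b u ((2 *: spray (randers h X) c x y + u *m dder (frame_mx c) x y)
               *m coframe_mx c x) w
  = - dFsq b u (frame_bracket c x u w).
Proof.
move=> ac cx u0 y; have yM : y *m coframe_mx c x = u.
  by rewrite -mulmxA frame_coframe // mulmx1.
have y0 : y != 0 by apply: contra_neq u0 => y0; rewrite -yM y0 mul0mx.
have := @spray_frame _ _ _ (randers h X) c b (coframe_mx c)
  (fun z y cz => randers_frame y ac cz) sqr_coord_lt1
  (fun z cz => coframe_unit ac cz) (fun z cz => coframe_differentiable ac cz)
  x y (w *m frame_mx c x) cx y0.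
rewrite yM -[w *m _ *m coframe_mx c x]mulmxA frame_coframe // mulmx1.
rewrite !diff_coframe //.
have CDC v D : v *m - (coframe_mx c x *m D *m coframe_mx c x)
    = - (v *m coframe_mx c x *m D *m coframe_mx c x).
  by rewrite mulmxN (mulmxA v) (mulmxA v).
rewrite !CDC yM -[w *m _ *m coframe_mx c x]mulmxA frame_coframe // mulmx1 => HS.
(* By [HS], twice the Hessian of the spray term contains minus the Hessian of [u dE(y)]. This
   cancels against the second summand, and the two [dFsq] terms left over make up the bracket. *)
rewrite mulmxDl -scalemxAl hessFsq_linear HS /frame_bracket mulmxBl.
set A := u *m _ *m _; set B := w *m _ *m _; set C := u *m _ *m _.
rewrite hessFsqN !dFsqN (_ : B - C = 1 *: B - C) ?scale1r // -{2}[B]scale1r.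
by rewrite dFsq_linear dFsqN; ring.
Qed.

Lemma douglas_bracket : douglas_type (randers h X) ->
  forall c x u w, atlas c -> cimg c x -> dotv b (frame_bracket c x u w) = 0.
Proof.
move=> dF c x u w ac cx; have b1 := sqr_coord_lt1.
have [->|u0] := eqVneq u 0; first by rewrite frame_bracketC frame_bracket0r oppr0 dotv0.
have [Gam [P [_ SE]]] := dF c ac.
pose Q y : 'rV[R]_n := \row_i \sum_j \sum_k Gam x i j k * y 0 j * y 0 k.
(* The geodesic defect in frame coordinates, without the multiple of [y] coming from [P] and with
   twice the spray replaced by its quadratic part. *)
pose A u := (Q (u *m frame_mx c x) + u *m dder (frame_mx c) x (u *m frame_mx c x))
  *m coframe_mx c x.
have AN : A (- u) = A u.
  rewrite /A !mulNmx dderN mulmxN opprK; congr ((_ + _) *m _).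
  apply/rowP => i; rewrite !mxE; apply: eq_bigr => j _; apply: eq_bigr => k _.
  have N0 (v : 'rV[R]_n) l : (- v) 0 l = - v 0 l by rewrite mxE.
  by rewrite !N0 !mulrN mulNr opprK.
have key v : v != 0 -> dotv (A v) w - dotv v (A v) * dotv v w / dotv v v
    = - dotv v (frame_bracket c x v w) - enorm v * dotv b (frame_bracket c x v w).
  move=> v0; set y := v *m frame_mx c x; have yM : y *m coframe_mx c x = v.
    by rewrite -mulmxA frame_coframe // mulmx1.
  have y0 : y != 0 by apply: contra_neq v0 => y0; rewrite -yM y0 mul0mx.
  have SQ : 2 *: spray (randers h X) c x y = Q y + (2 * P x y) *: y.
    apply/rowP => i; rewrite [LHS]mxE SE // mulrDr !mxE !mulrA divff ?pnatr_eq0 //.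
    by rewrite mul1r.
  have HT := fun w => spray_geodesic_defect w ac cx v0.
  have AE : (2 *: spray (randers h X) c x y + v *m dder (frame_mx c) x y) *m coframe_mx c x
      = A v + (2 * P x y) *: v.
    by rewrite SQ addrAC mulmxDl -scalemxAl yM.
  have := @hessFsq_solve _ _ b v (A v + (2 * P x y) *: v) (frame_bracket c x v) b1 v0
    (frame_bracket_self c x v) _ w.
  move=> <-; last by move=> w'; rewrite -AE; exact: spray_geodesic_defect.
  have vv : dotv v v != 0 by rewrite dotvv_eq0.
  by rewrite dotvDl dotvDr dotvZl dotvZr; field.
(* Under [u -> - u] the left side of [key] and the term [<u, [u, w]>] are unchanged, while [|u| <b,
   [u, w]>] changes sign and must vanish. *)
have k1 := key u u0; have k2 := key (- u); rewrite oppr_eq0 in k2.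
have := k2 u0; rewrite AN frame_bracketN !dotvNl !dotvNr opprK.
have -> : enorm (- u) = enorm u by rewrite /enorm dotvNl dotvNr opprK.
have e0 : enorm u != 0 by rewrite gt_eqF ?enorm_gt0.
have vv : dotv u u != 0 by rewrite dotvv_eq0.
move=> k3; apply: (mulfI e0); rewrite mulr0.
move: k1 k3.
set p := dotv (A u) w; set q := dotv u (A u); set r := dotv u w.
set s := dotv u (frame_bracket c x u w); set t := enorm u * _.
have -> : - q * - r / dotv u u = q * r / dotv u u by rewrite mulrNN.
rewrite [enorm u * - _]mulrN -/t => k1 k3; lra.
Qed.

(** Once [<b, [u, w]>] vanishes, [dFsq] on the bracket is [<u, [u, w]>] times the nonzero factor
    [2 F / |u|]; nondegeneracy of the Hessian and invertibility of the coframe do the rest. *)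
Lemma geodesic_defect_eq0 : douglas_type (randers h X) ->
  forall c x u, atlas c -> cimg c x -> u != 0 ->
  (2 *: spray (randers h X) c x (u *m frame_mx c x)
    + u *m dder (frame_mx c) x (u *m frame_mx c x) = 0)
  <-> (forall w, dotv u (frame_bracket c x u w) = 0).
Proof.
move=> dF c x u ac cx u0; have b1 := sqr_coord_lt1.
have F0 := randersF_neq0 b1 u0; have e0 := gt_eqF (enorm_gt0 u0).
have H w := spray_geodesic_defect w ac cx u0.
have dE w : dFsq b u (frame_bracket c x u w) = 0 <-> dotv u (frame_bracket c x u w) = 0.
  rewrite /dFsq /dranders douglas_bracket // addr0; split=> [/eqP|->];
    last by rewrite mul0r mulr0.
  by rewrite !mulf_eq0 pnatr_eq0 (negPf F0) invr_eq0 e0 /= orbF => /eqP.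
split=> [S0 w|uB].
  apply/dE/eqP; rewrite -oppr_eq0 -H S0 mul0mx.
  by rewrite /hessFsq /dranders !dotv0 dot0v !mul0r !(mulr0, mul0r, addr0, subrr).
have := coframe_unit ac cx; set T := 2 *: _ + _ => Cu.
have TC : T *m coframe_mx c x = 0.
  apply: (hessFsq_nondeg b1 u0) => w; rewrite H; apply/eqP.
  by rewrite oppr_eq0; apply/eqP/dE.
by rewrite -[T](mulmxK Cu) TC mul0mx.
Qed.
End Frame.

(** * Ordinary differential equations *)

Section RowNorm.
Context {R : realFieldType} {n : nat}.
Implicit Types (v w : 'rV[R]_n).

Lemma row_norm_le v (C : R) : 0 <= C -> (forall i, `|v 0 i| <= C) -> `|v| <= C.
Proof.
move=> C0 vC; rewrite [leLHS]/Num.Def.normr /= mx_normrE.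
by apply: bigmax_le => // -[i j] _; rewrite /= ord1.
Qed.

Lemma coord_norm_le v i : `|v 0 i| <= `|v|.
Proof.
rewrite [leRHS]/Num.Def.normr /= mx_normrE.
exact: (@le_bigmax _ _ _ 0 (fun ij => `|v ij.1 ij.2|) (0, i)).
Qed.
End RowNorm.

(** The norm of a row is the maximum of its entries, so the scalar mean value theorem on each
    coordinate gives the bound with the same constant. *)
Lemma mean_value_itv (R : realType) n (f f' : R -> 'rV[R]_n) (C a b : R) : a <= b ->
  (forall s : R, a <= s <= b -> is_derive s 1 f (f' s)) ->
  (forall s, a <= s <= b -> `|f' s| <= C) -> `|f b - f a| <= C * (b - a).
Proof.
move=> ab df f'C.
have C0 : 0 <= C by apply: le_trans (f'C a _) => //; rewrite lexx.
apply: row_norm_le => [|i]; first by rewrite mulr_ge0 ?subr_ge0.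
pose F (z : R) : R := f z 0 i; pose F' (z : R) : R := f' z 0 i.
have dF s : s \in `[a, b] -> is_derive s 1 F (F' s).
  by rewrite in_itv /= => /df /is_derive_mxP/(_ 0 i).
have cF : {within `[a, b], continuous F}.
  by apply: derivable_within_continuous => s /dF[].
have [s sab FE] := MVT_segment ab (fun s sab => dF s (subset_itv_oo_cc sab)) cF.
rewrite !mxE -/(F a) -/(F b) FE; rewrite in_itv /= in sab.
rewrite normrM (ger0_norm (_ : 0 <= b - a)) ?subr_ge0 // ler_wpM2r ?subr_ge0 //.
exact: le_trans (coord_norm_le _ _) (f'C s sab).
Qed.

Lemma mean_value_le (R : realType) n (f f' : R -> 'rV[R]_n) (C t : R) :
  (forall s : R, `|s| <= `|t| -> is_derive s 1 f (f' s)) ->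
  (forall s, `|s| <= `|t| -> `|f' s| <= C) -> `|f t - f 0| <= C * `|t|.
Proof.
move=> df f'C; have [t0|t0] := leP 0 t.
  have st s : 0 <= s <= t -> `|s| <= `|t| by move=> /andP[s0 st]; rewrite !ger0_norm.
  rewrite [in leRHS](ger0_norm t0) -[X in _ * X]subr0.
  by apply: mean_value_itv => // s /st; [exact: df|exact: f'C].
have st s : t <= s <= 0 -> `|s| <= `|t|.
  by move=> /andP[ts s0]; rewrite !ler0_norm ?lerN2 // ltW.
rewrite distrC [in leRHS]ltr0_norm // -(sub0r t).
by apply: mean_value_itv => [|s /st|s /st]; [exact: ltW|exact: df|exact: f'C].
Qed.

Lemma klipschitz_continuous (R : realFieldType) (V W : normedModType R)
    (f : V -> W) (K : R) :
  (forall x y, `|f x - f y| <= K * `|x - y|) -> continuous f.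
Proof.
move=> fK x; apply/cvgrPdist_le => e e0.
have K1 : 0 < `|K| + 1 by rewrite ltr_wpDl.
near=> y; apply: (le_trans (fK x y)).
apply: (@le_trans _ _ ((`|K| + 1) * `|x - y|)).
  by rewrite ler_wpM2r // (le_trans (ler_norm K)) // lerDl.
rewrite -ler_pdivlMl // mulrC.
near: y; apply: cvgr_dist_le; [exact: cvg_id|exact: divr_gt0].
Unshelve. all: by end_near. Qed.

(* Clamping time and space lets the Picard operator act on curves defined on all
   of [R], with a globally Lipschitz right-hand side. *)
Section Clamp.
Context {R : realFieldType}.
Implicit Types (r s t : R).

Definition clamp r t : R := if t <= - r then - r else if r <= t then r else t.

Lemma clamp_le r t : 0 <= r -> `|clamp r t| <= r.
Proof.
move=> r0; rewrite ler_norml /clamp.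
by case: (leP t (- r)) => ?; [|case: (leP r t) => ?]; apply/andP; split; lra.
Qed.

Lemma clamp_id r t : `|t| <= r -> clamp r t = t.
Proof.
rewrite ler_norml /clamp => /andP[rt tr].
by case: (leP t (- r)) => ?; [|case: (leP r t) => ?]; lra.
Qed.

Lemma clamp_lipschitz r s t : 0 <= r -> `|clamp r s - clamp r t| <= `|s - t|.
Proof.
move=> r0; wlog st : s t / s <= t => [H|].
  by have [/H|/ltW/H] := leP s t; rewrite // distrC (distrC t).
rewrite distrC (distrC s) (ger0_norm (_ : 0 <= t - s)) ?subr_ge0 // ler_norml /clamp.
case: (leP s (- r)) => ?; [|case: (leP r s) => ?];
  (case: (leP t (- r)) => ?; [|case: (leP r t) => ?]); apply/andP; split; lra.
Qed.
End Clamp.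

Lemma near_norm_lt (R : realFieldType) (t d : R) :
  `|t| < d -> \forall s \near t, `|s| < d.
Proof.
by move=> td; apply: (@cvgr_norm_lt _ _ _ (nbhs t) _ id t) td; exact: cvg_id.
Qed.

Lemma geometric_small (R : archiRealFieldType) (C e : R) : 0 <= C -> 0 < e ->
  exists k, C / 2 ^+ k < e.
Proof.
move=> C0 e0; exists (Num.bound (C / e)).
rewrite ltr_pdivrMr ?exprn_gt0 // mulrC -ltr_pdivrMr //.
apply: lt_trans (archi_boundP _) _; first by rewrite divr_ge0 // ltW.
by rewrite -natrX ltr_nat ltn_expl.
Qed.

Lemma geometric_cvg (R : realType) n (u : nat -> 'rV[R]_n) (C : R) :
  (forall k, `|u k.+1 - u k| <= C / 2 ^+ k) ->
  exists l, forall k, `|l - u k| <= 2 * C / 2 ^+ k.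
Proof.
move=> uC.
have C0 : 0 <= C by have := le_trans (normr_ge0 _) (uC 0); rewrite expr0 divr1.
have p0 k : 0 < 2 ^+ k :> R by rewrite exprn_gt0.
(* The subtracted tail makes the bound telescope, which is what the induction on [m] needs. *)
have dist k m : `|u (k + m)%N - u k| <= 2 * C / 2 ^+ k - 2 * C / 2 ^+ (k + m).
  elim: m => [|m IH]; first by rewrite addn0 !subrr normr0.
  rewrite addnS -(subrKA (u (k + m)%N)).
  apply: (le_trans (ler_normD _ _)); have := uC (k + m)%N.
  rewrite exprS; have := p0 (k + m)%N; move: (2 ^+ (k + m)) IH => p IH p_gt0 uC'.
  have -> : 2 * C / (2 * p) = C / p by field; rewrite gt_eqF.
  by move: IH uC'; rewrite -mulrA; lra.
have distk k m : (k <= m)%N -> `|u m - u k| <= 2 * C / 2 ^+ k.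
  move=> /subnKC <-; apply: (le_trans (dist _ _)).
  by rewrite lerBlDr lerDl divr_ge0 ?mulr_ge0 // ltW.
have /cvg_ex[l ul] : cvgn u.
  apply/cauchy_cvgP/cauchy_exP => e e0;
  have [k ke] := geometric_small (mulr_ge0 (ler0n R 2) C0) e0.
  exists (u k); suff : \forall m \near \oo, ball (u k) e (u m) by [].
  near=> m; rewrite -ball_normE /= distrC.
  by apply: le_lt_trans ke; apply: distk; near: m; exact: nbhs_infty_ge.
exists l => k; apply/ler_addgt0Pr => e e0.
near \oo => m; rewrite -(subrKA (u m)) addrC; apply: (le_trans (ler_normD _ _)).
apply: lerD; first by apply: distk; near: m; exact: nbhs_infty_ge.
by near: m; move/cvgrPdist_le: ul; apply.
Unshelve. all: by end_near. Qed.

Lemma is_derive_continuous (R : numFieldType) (W : normedModType R) (f : R -> W) (t : R) d :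
  is_derive t 1 f d -> {for t, continuous f}.
Proof. by case=> /derivable1_diffP/differentiable_continuous. Qed.

(** At a point [c] where the distance of the two solutions is maximal on [[- |t|, |t|]], the mean
    value inequality bounds this maximum by [K |c| <= 1/2] times itself, so it is zero. *)
Lemma lipschitz_ode_unique (R : realType) n (f : 'rV[R]_n -> 'rV[R]_n) (K e : R)
    (x y : R -> 'rV[R]_n) :
  (forall z w, `|f z - f w| <= K * `|z - w|) -> 0 <= K -> K * e <= 2^-1 ->
  (forall t : R, `|t| < e -> is_derive t 1 x (f (x t))) ->
  (forall t : R, `|t| < e -> is_derive t 1 y (f (y t))) ->
  x 0 = y 0 -> forall t, `|t| < e -> x t = y t.
Proof.
move=> fK K0 Ke dx dy xy0 t te.
pose D s := x s - y s.
have dD (s : R) : `|s| < e -> is_derive s 1 D (f (x s) - f (y s)).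
  by move=> se; apply: is_deriveB; [exact: dx|exact: dy].
have st s : s \in `[- `|t|, `|t|] -> `|s| <= `|t| by rewrite in_itv /= ler_norml.
have cD : {within `[- `|t|, `|t|], continuous (fun s => `|D s|)}.
  have cD : {within `[- `|t|, `|t|], continuous D}.
    apply: derivable_within_continuous => s /st se.
    by have [] := dD s (le_lt_trans se te).
  by move=> s; apply: continuous_comp; [exact: cD|exact: norm_continuous].
have [|c /st ct cmax] := EVT_max _ cD; first by rewrite ge0_cp.
have Dc : `|D c - D 0| <= K * `|D c| * `|c|.
  apply: mean_value_le => s sc.
    exact/dD/(le_lt_trans sc)/(le_lt_trans ct).
  apply: (le_trans (fK _ _)); rewrite ler_wpM2l // cmax // in_itv /= -ler_norml.
  exact: le_trans ct.
have D0 : D 0 = 0 by rewrite /D xy0 subrr.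
have Dc0 : `|D c| <= 0.
  move: Dc; rewrite D0 subr0 mulrAC => Dc.
  have : K * `|c| <= 2^-1.
    by apply: le_trans Ke; rewrite ler_wpM2l // ltW // (le_lt_trans ct).
  move=> Kc; have := ler_wpM2r (normr_ge0 (D c)) Kc; lra.
apply/eqP; rewrite -subr_eq0 -normr_le0; apply: le_trans Dc0.
by apply: cmax; rewrite in_itv /= -ler_norml.
Qed.

(** * Picard iteration *)

Section Picard.
Context {R : realType} {n : nat}.
Local Notation V := 'rV[R]_n.
Local Notation mu := (@lebesgue_measure R).

(** The integral starts at [- a], so that the fundamental theorem covers negative [t] as well; the
    subtracted constant makes the value at 0 vanish. *)
Definition primitive (a : R) (phi : R -> R) (t : R) : R :=
  \int[mu]_(s in `[- a, t]) phi s - \int[mu]_(s in `[- a, 0]) phi s.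

Lemma is_derive_primitive (a : R) (phi : R -> R) (t : R) : continuous phi -> `|t| < a ->
  is_derive t 1 (primitive a phi) (phi t).
Proof.
move=> cphi; rewrite ltr_norml => /andP[at1 ta].
have int : mu.-integrable `[- a, a] (EFin \o phi).
  apply: continuous_compact_integrable; first exact: segment_compact.
  exact: continuous_subspaceT.
have [dF F'] := continuous_FTC1_closed ta int at1 (cphi t).
have dI : is_derive t 1 (fun x => \int[mu]_(t in `[- a, x]) phi t) (phi t).
  by apply: DeriveDef; [exact: dF|rewrite -derive1E; exact: F'].
have := is_derive_addf dI (is_derive_cst (- \int[mu]_(s in `[- a, 0]) phi s) t 1).
by rewrite addr0.
Qed.

Variables (f : V -> V) (K d : R) (x0 : V).
Hypothesis fK : forall z w, `|f z - f w| <= K * `|z - w|.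
Hypothesis K0 : 0 <= K.
Hypothesis d0 : 0 < d.
Hypothesis Kd : K * d <= 2^-1.

(** With the bound [d + 1] in place of [d], every [t] with [|t| <= d] is an interior point of the
    interval of integration, so [Q x] is differentiable up to the ends. *)
Let Q (x : R -> V) (t : R) : V :=
  x0 + \row_i primitive (d + 1) (fun s => f (x s) 0 i) t.
Let P (x : R -> V) (t : R) : V := Q x (clamp d t).

Let Q0 x : Q x 0 = x0.
Proof.
rewrite /Q (_ : \row_i _ = 0) ?addr0 //; apply/rowP => i.
by rewrite !mxE /primitive subrr.
Qed.

Let dQ x (t : R) : continuous x -> `|t| <= d -> is_derive t 1 (Q x) (f (x t)).
Proof.
move=> cx td; rewrite -[f (x t)]add0r.
apply: is_derive_addf (is_derive_cst x0 t 1) _.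
apply/is_derive_mxP => i j; rewrite ord1; under eq_fun do rewrite mxE.
apply: is_derive_primitive; last by rewrite (le_lt_trans td) // ltrDl.
have cf := klipschitz_continuous fK.
move=> s; apply: (@continuous_comp _ _ _ (f \o x) (fun v : V => v 0 j)).
  by apply: continuous_comp; [exact: cx|exact: cf].
exact: coord_continuous.
Qed.

Let cP x : continuous x -> continuous (P x).
Proof.
move=> cx t; apply: continuous_comp.
  by apply: (@klipschitz_continuous _ _ _ _ 1) => s s'; rewrite mul1r clamp_lipschitz // ltW.
by apply: is_derive_continuous; apply: dQ => //; rewrite clamp_le // ltW.
Qed.

(** The two images agree at 0 and their derivatives differ by at most [K C], over a time at most [d]
    with [K d <= 1/2]. *)
Let P_contr x y C : continuous x -> continuous y ->
  (forall s, `|x s - y s| <= C) -> forall t, `|P x t - P y t| <= C / 2.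
Proof.
move=> cx cy xyC t; have C0 := le_trans (normr_ge0 _) (xyC 0).
have cd : `|clamp d t| <= d by rewrite clamp_le // ltW.
have : `|(Q x \- Q y) (clamp d t) - (Q x \- Q y) 0| <= K * C * `|clamp d t|.
  apply: mean_value_le => s st.
    by apply: is_deriveB; apply: dQ => //; exact: le_trans cd.
  by apply: (le_trans (fK _ _)); rewrite ler_wpM2l.
rewrite /= !Q0 subrr subr0 => /le_trans; apply.
have := ler_wpM2r C0 (le_trans (ler_wpM2l K0 cd) Kd).
by rewrite mulrAC [2^-1 * _]mulrC.
Qed.

Lemma picard_existence : exists gam : R -> V,
  [/\ gam 0 = x0, continuous gam
    & forall t : R, `|t| < d -> is_derive t 1 gam (f (gam t))].
Proof.
pose X k := iter k P (cst x0); pose C := `|f x0| * d.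
have cX k : continuous (X k) by elim: k => [|k IH]; [exact: cst_continuous|exact: cP].
have X1 t : `|X 1%N t - X 0%N t| <= C.
  have cd : `|clamp d t| <= d by rewrite clamp_le // ltW.
  rewrite /X /= -{2}(Q0 (cst x0)).
  have : `|Q (cst x0) (clamp d t) - Q (cst x0) 0| <= `|f x0| * `|clamp d t|.
    apply: mean_value_le => s st; last exact: lexx.
    by apply: dQ; [exact: cst_continuous|exact: le_trans cd].
  by move=> /le_trans; apply; rewrite ler_wpM2l.
have XC k t : `|X k.+1 t - X k t| <= C / 2 ^+ k.
  elim: k t => [|k IH] t; first by rewrite expr0 divr1.
  rewrite exprSr invfM mulrA; exact: (P_contr (cX _) (cX _) IH).
have /choice[gam gamX] : forall t, exists l, forall k, `|l - X k t| <= 2 * C / 2 ^+ k.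
  by move=> t; apply: (@geometric_cvg _ _ (X^~ t)).
have C0 : 0 <= 2 * C by rewrite !mulr_ge0 // ltW.
have arch e : 0 < e -> exists k, 2 * C / 2 ^+ k <= e.
  by move=> /(geometric_small C0)[k /ltW]; exists k.
have cgam : continuous gam.
  move=> t; apply/cvgrPdist_le => e e0.
  have [k ke] := arch (e / 3) (divr_gt0 e0 (ltr0Sn _ 2)).
  near=> s; have -> : gam t - gam s
      = (gam t - X k t) + (X k t - X k s) - (gam s - X k s).
    by rewrite addrA subrK opprB addrA subrK.
  rewrite (_ : e = e / 3 + e / 3 + e / 3); last by field.
  apply: (le_trans (ler_normB _ _)); apply: lerD; last exact: le_trans ke.
  apply: (le_trans (ler_normD _ _)); apply: lerD; first exact: le_trans ke.
  by near: s; have /cvgrPdist_le := cX k t; apply; rewrite divr_gt0.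
(* Both [gam] and [P gam] lie within [C / 2^k] of the iterate [X (k + 1)], the first by the rate of
   convergence, the second by contraction. *)
have fix_gam t : gam t = P gam t.
  apply/eqP; rewrite -subr_eq0 -normr_le0; apply/ler_addgt0Pr => e e0; rewrite add0r.
  have [k ke] := arch e e0; apply: le_trans ke.
  rewrite -(subrKA (X k.+1 t)); apply: (le_trans (ler_normD _ _)).
  have h1 := gamX t k.+1; have h2 := P_contr cgam (cX k) (fun s => gamX s k) t.
  rewrite [X in _ + X]distrC; move: h1 h2; rewrite exprS.
  have p0 : 0 < 2 ^+ k :> R by rewrite exprn_gt0.
  have -> : 2 * C / (2 * 2 ^+ k) = C / 2 ^+ k by field; rewrite gt_eqF.
  have -> : 2 * C / 2 ^+ k / 2 = C / 2 ^+ k by field; rewrite gt_eqF.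
  by rewrite /X /= -mulrA; lra.
exists gam; split=> //.
  by rewrite fix_gam /P clamp_id ?Q0 // normr0 ltW.
(* Near such a [t] the clamping of time is the identity, so the fixed point equation reads
   [gam = Q gam] there. *)
move=> t td; apply: (near_eq_is_derive (f := Q gam)); last exact: dQ (ltW td).
near=> s; rewrite [RHS]fix_gam /P clamp_id // ltW //.
by near: s; exact: near_norm_lt.
Unshelve. all: by end_near. Qed.
End Picard.

(** * Local flow of a C^1 vector field *)

Lemma near_closed_ball (R : realFieldType) (V : normedModType R) (x : V) (P : set V) :
  (\forall z \near x, P z) -> exists2 r, 0 < r & forall z, `|z - x| <= r -> P z.
Proof.
move=> /nbhs_ballP[e /= e0 eP]; exists (e / 2); first by rewrite divr_gt0.
move=> z zr; apply: eP; rewrite -ball_normE /= distrC (le_lt_trans zr) //.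
by rewrite gtr_pMr // invf_lt1 // ltr1n.
Qed.

(** [Ck_on 1] gives continuity of the derivative only for each fixed direction. Hence the [n]
    partial derivatives are bounded on a ball, their bounds are added to give [K], and the mean
    value inequality is applied along segments of this convex ball. *)
Lemma C1_locally_lipschitz (R : realType) n (f : 'rV[R]_n -> 'rV[R]_n)
    (U : set 'rV[R]_n) x0 :
  open U -> U x0 -> Ck_on 1 U f ->
  exists r K : R, [/\ 0 < r, 0 <= K, forall z, `|z - x0| <= r -> U z
    & forall z w, `|z - x0| <= r -> `|w - x0| <= r -> `|f z - f w| <= K * `|z - w|].
Proof.
move=> oU Ux0 [df cf]; pose B (j : 'I_n) := `|dder f x0 (delta_mx 0 j)| + 1.
have [r r0 rP] : exists2 r, 0 < r & forall z, `|z - x0| <= r ->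
    U z /\ forall j : 'I_n, `|dder f z (delta_mx 0 j)| <= B j.
  apply: near_closed_ball; apply: filterI.
    by apply: open_nbhs_nbhs; split.
  apply: (@filter_forall _ 'I_n (fun j z => `|dder f z (delta_mx 0 j)| <= B j) (nbhs x0)) => j.
  have cfj' : dder f z (delta_mx 0 j) @[z --> x0] --> dder f x0 (delta_mx 0 j).
    by rewrite dder.unlock; exact: (cf (delta_mx 0 j) x0 Ux0).
  have cfb : \forall z \near x0, `|dder f z (delta_mx 0 j)| < B j.
    have xB : `|dder f x0 (delta_mx 0 j)| < B j by rewrite /B ltrDl.
    exact: (cvgr_norm_lt _ cfj' _ xB).
  by apply: filterS cfb => z /ltW.
exists r, (\sum_j B j); split => // [|z /rP[]//|z w zr wr].
  by apply: sumr_ge0 => j _; rewrite addr_ge0.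
pose p (s : R) := s *: (z - w) + w.
have p1 : p 1 = z by rewrite /p scale1r subrK.
have p0 : p 0 = w by rewrite /p scale0r add0r.
have pr s : 0 <= s <= 1 -> `|p s - x0| <= r.
  move=> /andP[s0 s1].
  have -> : p s - x0 = s *: (z - x0) + (1 - s) *: (w - x0).
    by rewrite /p; apply/rowP => i; rewrite !mxE; ring.
  have s1' : 0 <= 1 - s by rewrite subr_ge0.
  apply: (le_trans (ler_normD _ _)); rewrite !normrZ !ger0_norm //.
  by have := ler_wpM2l s0 zr; have := ler_wpM2l s1' wr; lra.
have dp (s : R) : is_derive s 1 p (z - w).
  have := is_derive_addf (is_derive_scalel s (z - w)) (is_derive_cst w s 1).
  by rewrite addr0.
rewrite -p1 -p0 -[X in _ * X](mulr1) -[X in _ * (_ * X)]subr0 mulrA.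
apply: (@mean_value_itv _ _ (f \o p) (fun s => dder f (p s) (z - w))) => // s /pr /rP[Ups Bs].
  exact: is_derive_diff_comp (dp s) (df _ Ups).
rewrite p1 p0 (row_sum_delta (z - w)).
have -> : dder f (p s) (\sum_j (z - w) 0 j *: delta_mx 0 j)
    = \sum_j (z - w) 0 j *: dder f (p s) (delta_mx 0 j).
  rewrite -dderE linear_sum; apply: eq_bigr => j _.
  by rewrite linearZ dderE.
rewrite -row_sum_delta mulr_suml; apply: (le_trans (ler_norm_sum _ _ _)).
apply: ler_sum => j _; rewrite normrZ mulrC.
by apply: ler_pM => //; exact: coord_norm_le.
Qed.

(** A retraction onto the closed ball of radius [r], which is a cube for the maximum norm; for that
    norm it is 1-Lipschitz. *)
Definition clamp_row (R : realFieldType) n (x0 : 'rV[R]_n) (r : R) (z : 'rV[R]_n) : 'rV[R]_n :=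
  x0 + \row_i clamp r ((z - x0) 0 i).

Lemma clamp_row_le (R : realFieldType) n (x0 : 'rV[R]_n) r z : 0 <= r ->
  `|clamp_row x0 r z - x0| <= r.
Proof.
move=> r0; rewrite /clamp_row addrC addKr; apply: row_norm_le => // i.
by rewrite mxE clamp_le.
Qed.

Lemma clamp_row_id (R : realFieldType) n (x0 : 'rV[R]_n) r z :
  `|z - x0| <= r -> clamp_row x0 r z = z.
Proof.
move=> zr; rewrite /clamp_row; apply/rowP => i; rewrite mxE [X in _ + X]mxE clamp_id.
  by rewrite !mxE addrC subrK.
exact: le_trans (coord_norm_le _ _) zr.
Qed.

Lemma clamp_row_lipschitz (R : realFieldType) n (x0 : 'rV[R]_n) r z w : 0 <= r ->
  `|clamp_row x0 r z - clamp_row x0 r w| <= `|z - w|.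
Proof.
move=> r0; apply: row_norm_le => // i.
have -> : (clamp_row x0 r z - clamp_row x0 r w) 0 i
    = clamp r ((z - x0) 0 i) - clamp r ((w - x0) 0 i).
  by rewrite /clamp_row !mxE; ring.
apply: (le_trans (clamp_lipschitz _ _ r0)).
have -> : (z - x0) 0 i - (w - x0) 0 i = (z - w) 0 i by rewrite !mxE; ring.
exact: coord_norm_le.
Qed.

Theorem local_flow (R : realType) n (f : 'rV[R]_n -> 'rV[R]_n)
    (U : set 'rV[R]_n) x0 :
  open U -> U x0 -> Ck_on 1 U f ->
  exists r d : R, [/\ 0 < r, 0 < d, forall z, `|z - x0| <= r -> U z,
    exists gam : R -> 'rV[R]_n, gam 0 = x0 /\ forall t : R, `|t| < d ->
      `|gam t - x0| < r /\ is_derive t 1 gam (f (gam t))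
    & forall (x y : R -> 'rV[R]_n) (e : R), e <= d -> x 0 = y 0 ->
      (forall t : R, `|t| < e -> `|x t - x0| <= r /\ is_derive t 1 x (f (x t))) ->
      (forall t : R, `|t| < e -> `|y t - x0| <= r /\ is_derive t 1 y (f (y t))) ->
      forall t, `|t| < e -> x t = y t].
Proof.
move=> oU Ux0 Cf; have [r [K [r0 K0 rU fK]]] := C1_locally_lipschitz oU Ux0 Cf.
(* Precomposing with the retraction gives a globally Lipschitz field that agrees with [f] on the
   ball; curves that stay in the ball solve both equations. *)
pose F z := f (clamp_row x0 r z); have r0' := ltW r0.
have FK z w : `|F z - F w| <= K * `|z - w|.
  apply: (le_trans (fK _ _ (clamp_row_le x0 z r0') (clamp_row_le x0 w r0'))).
  by rewrite ler_wpM2l // clamp_row_lipschitz.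
have Ff z : `|z - x0| <= r -> F z = f z by move=> zr; rewrite /F clamp_row_id.
(* Chosen so that [K d1 <= 1/2]; adding 1 to [K] avoids dividing by zero when [K = 0]. *)
pose d1 := (2 * (K + 1))^-1.
have K1 : 0 < K + 1 by rewrite ltr_wpDl.
have d10 : 0 < d1 by rewrite invr_gt0 mulr_gt0.
have Kd1 : K * d1 <= 2^-1.
  rewrite /d1 invfM mulrCA -[leRHS]mulr1 ler_wpM2l // ler_pdivrMr // mul1r.
  by rewrite lerDl.
have [gam [gam0 cgam dgam]] := picard_existence x0 FK K0 d10 Kd1.
have [d2 d20 gamr] : exists2 d2, 0 < d2 & forall t, `|t| <= d2 -> `|gam t - x0| < r.
  have : \forall t \near (0 : R), `|gam t - x0| < r.
    near=> t; rewrite distrC; near: t.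
    by apply: cvgr_dist_lt => //; rewrite -gam0; exact: cgam.
  by move=> /near_closed_ball[d2 d20 H]; exists d2 => // t td; apply: H; rewrite subr0.
exists r, (Num.min d1 d2); split => //; first by rewrite lt_min d10.
  exists gam; split=> // t; rewrite lt_min => /andP[t1 t2].
  have tr := gamr t (ltW t2); split=> //.
  by rewrite -Ff ?ltW //; exact: dgam.
move=> x y e ed xy0 dx dy.
have ed1 : K * e <= 2^-1.
  apply: le_trans Kd1; rewrite ler_wpM2l // (le_trans ed) // ge_min lexx //.
apply: (lipschitz_ode_unique FK K0 ed1) => // t /[dup] te.
  by move=> /dx[xr dxt]; rewrite Ff.
by move=> /dy[yr dyt]; rewrite Ff.
Unshelve. all: by end_near. Qed.

(** * One-parameter subgroups *)

Section LeftTranslation.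
Context {R : realType} {n : nat} {G : lieGroupType R n}.
Implicit Types (c : chart R n G) (p q : G) (x : R -> G) (s t : R).

(** Smoothness is given for the multiplication in two variables, so a chart at [q] is chosen and the
    translation is its restriction to the slice [v |-> (q, v)]. *)
Lemma differentiable_ltrans c c' q p : atlas c -> atlas c' ->
  cdom c p -> cdom c' (q * p)%g ->
  differentiable (cmap c' \o (fun r => (q * r)%g) \o cinv c) (cmap c p).
Proof.
move=> ac ac' cp cqp; have [c0 ac0 c0q] := atlas_cover q.
have [/(_ (cmap c0 q, cmap c p)) dm _] := lie_mul_smooth _ _ _ ac0 ac ac' 1%N.
have qK : cinv c0 (cmap c0 q) = q by rewrite cmapK ?inE.
have pK : cinv c (cmap c p) = p by rewrite cmapK ?inE.
have dm' : differentiable (fun uv => cmap c' (cinv c0 uv.1 * cinv c uv.2)%g)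
    (cmap c0 q, cmap c p).
  by apply: dm; rewrite /= qK pK; split=> //; exact: cimg_cmap.
have -> : cmap c' \o (fun r => (q * r)%g) \o cinv c
    = (fun uv => cmap c' (cinv c0 uv.1 * cinv c uv.2)%g) \o (fun v => (cmap c0 q, v)).
  by apply/funext => v /=; rewrite qK.
by apply: differentiable_comp.
Qed.

Lemma is_derive_ltrans c c' q x t v : atlas c -> atlas c' ->
  cdom c' (q * x t)%g -> (\forall s \near t, cdom c (x s)) ->
  is_derive t 1 (cmap c \o x) v ->
  is_derive t 1 (fun s => cmap c' (q * x s)%g)
    (tangent_map (fun r => (q * r)%g) c c' (x t) v).
Proof.
move=> ac ac' cqx ncx dx; have cx : cdom c (x t) by exact: nbhs_singleton ncx.
have dL := differentiable_ltrans ac ac' cx cqx.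
rewrite /tangent_map dderE.
apply: near_eq_is_derive (is_derive_diff_comp dx dL).
by near=> s => /=; rewrite cmapK ?inE //; near: s.
Unshelve. all: by end_near. Qed.

Lemma near_cdom c x t : {for t, continuous x} -> cdom c (x t) ->
  \forall s \near t, cdom c (x s).
Proof. by move=> cx cxt; apply: cx; apply: open_nbhs_nbhs; split=> //; exact: cdom_open. Qed.

Variable Y : chart R n G -> G -> 'rV[R]_n.
Hypothesis lY : forall q p c c', atlas c -> atlas c' -> cdom c p -> cdom c' (q * p)%g ->
  Y c' (q * p)%g = tangent_map (fun r => (q * r)%g) c c' p (Y c p).

(** The definition prescribes the velocity at time 0 only. As [x (t + h) = x t * x h], the velocity
    at [t] is its left translate, which is the value of [Y] there. *)
Lemma one_parameter_subgroup_ode x : one_parameter_subgroup Y x ->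
  forall t c, atlas c -> cdom c (x t) -> is_derive t 1 (cmap c \o x) (Y c (x t)).
Proof.
move=> [cx xD dx] t c' ac' cxt; have [c ac c1] := @atlas_cover R n G 1%g.
have x0 : x 0 = 1%g.
  by apply: (mulgI (x 0)); rewrite -xD addr0 mulg1.
apply/is_derive_line.
have -> : (fun h : R => (cmap c' \o x) (h *: 1 + t)) = (fun h => cmap c' (x t * x h)%g).
  by apply/funext => h /=; rewrite -xD [_ *: _]mulr1 addrC.
have cx0 : cdom c (x 0) by rewrite x0.
have cxt0 : cdom c' (x t * x 0)%g by rewrite x0 mulg1.
have := is_derive_ltrans ac ac' cxt0 (near_cdom (cx 0) cx0) (dx c ac c1).
by rewrite -[in Y c 1%g]x0 -lY // x0 mulg1.
Qed.

Hypothesis dY : forall c z, atlas c -> cimg c z ->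
  differentiable (fun z => Y c (cinv c z)) z.

(** Since [x' = Y(x)] holds near every time, [x''] is the derivative of [Y] along [Y], and the
    geodesic equation becomes a condition on [Y] at the points of the curve. *)
Lemma one_parameter_subgroup_geodesic F x : one_parameter_subgroup Y x ->
  geodesic F x <-> forall t c, atlas c -> cdom c (x t) ->
    dder (fun z => Y c (cinv c z)) (cmap c (x t)) (Y c (x t))
    = - 2 *: spray F c (cmap c (x t)) (Y c (x t)).
Proof.
move=> ox; have [cx _ _] := ox; have ode := one_parameter_subgroup_ode ox.
have main t c : atlas c -> cdom c (x t) ->
    [/\ \forall s \near t, derivable (cmap c \o x) s 1,
        derive1 (cmap c \o x) t = Y c (x t)
      & is_derive t 1 (derive1 (cmap c \o x))
          (dder (fun z => Y c (cinv c z)) (cmap c (x t)) (Y c (x t)))].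
  move=> ac ct; have nc := near_cdom (cx t) ct.
  have dX := ode t c ac ct; split.
  - by near=> s; apply: ex_derive; apply: ode => //; near: s.
  - by rewrite derive1E derive_val.
  - have dYx := dY ac (cimg_cmap ct).
    apply: near_eq_is_derive (is_derive_diff_comp dX dYx).
    near=> s => /=; have cs : cdom c (x s) by near: s.
    have dXs := ode s c ac cs.
    by rewrite derive1E derive_val cmapK ?inE.
split=> [gx t c ac ct|H t c ac ct].
  have [_ X1 X2] := main t c ac ct; have [_ _] := gx t c ac ct.
  by rewrite X1 derive1E derive_val.
have [dX X1 X2] := main t c ac ct; split => //.
by rewrite X1 derive1E derive_val; exact: H.
Unshelve. all: by end_near. Qed.
End LeftTranslation.

Section ExtendLocalHomomorphism.
Context {R : realType} {G : groupType}.
Variables (x : R -> G) (e : R).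
Hypothesis e0 : 0 < e.
Hypothesis xD : forall s t, `|s| < e -> `|t| < e -> x (s + t) = (x s * x t)%g.

Let x0 : x 0 = 1%g.
Proof. by apply: (mulgI (x 0)); rewrite -xD ?normr0 // addr0 mulg1. Qed.

Let xX s m : `|m%:R * s| < e -> x (m%:R * s) = (x s ^+ m)%g.
Proof.
elim: m => [|m IH] ms; first by rewrite mul0r x0 expg0.
have m1s : `|m%:R * s| < e.
  apply: le_lt_trans ms; rewrite !normrM ler_wpM2r // !ger0_norm //.
  by rewrite ler_nat.
have s1 : `|s| < e.
  apply: le_lt_trans ms; rewrite normrM ger0_norm // ler_peMl //.
  by rewrite ler1n.
by rewrite -natr1 mulrDl mul1r xD // IH // expgSr.
Qed.

Let small (t : R) : nat := (Num.bound (`|t| / e)).+1.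

Let smallP (t : R) m : (small t <= m)%N -> (0 < m)%N /\ `|t / m%:R| < e.
Proof.
move=> tm; have m0 : (0 < m)%N by exact: leq_trans tm.
split=> //; rewrite normrM normfV (ger0_norm (ler0n R m)) ltr_pdivrMr ?ltr0n //.
rewrite mulrC -ltr_pdivrMr //.
apply: lt_le_trans (archi_boundP _) _; first by rewrite divr_ge0 // ltW.
by rewrite ler_nat (leq_trans _ tm) // /small.
Qed.

(** Both sides equal the power with exponent [m k], so the extension will not depend on the
    subdivision of [t]. *)
Let powE (t : R) m k : (0 < m)%N -> (0 < k)%N -> `|t / m%:R| < e -> `|t / k%:R| < e ->
  (x (t / m%:R) ^+ m = x (t / k%:R) ^+ k)%g.
Proof.
have main a l : (0 < a)%N -> (0 < l)%N -> `|t / a%:R| < e ->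
    (x (t / a%:R) ^+ a = x (t / (a * l)%:R) ^+ (a * l))%g.
  move=> a0 l0 ta.
  have tE : t / a%:R = l%:R * (t / (a * l)%:R).
    by rewrite natrM; field; rewrite !pnatr_eq0 -!lt0n a0 l0.
  by rewrite {1}tE xX -?tE // -expgnA mulnC.
by move=> m0 k0 tm tk; rewrite (main m k) // (main k m) // mulnC.
Qed.

Lemma extend_local_homomorphism : exists y : R -> G,
  (forall s t, y (s + t) = (y s * y t)%g) /\ (forall t, `|t| < e -> y t = x t).
Proof.
exists (fun t => x (t / (small t)%:R) ^+ small t)%g; split=> [s t|t te].
  (* A single exponent fine enough for [s], [t] and [s + t]. *)
  pose m := (small s + small t + small (s + t))%N.
  have [m0 sm] : (0 < m)%N /\ `|s / m%:R| < e by apply: smallP; rewrite /m -addnA leq_addr.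
  have [_ tm] : (0 < m)%N /\ `|t / m%:R| < e by apply: smallP; rewrite /m addnAC leq_addl.
  have [_ stm] : (0 < m)%N /\ `|(s + t) / m%:R| < e by apply: smallP; rewrite /m leq_addl.
  have E r : `|r / m%:R| < e -> (x (r / (small r)%:R) ^+ small r = x (r / m%:R) ^+ m)%g.
    by move=> rm; apply: powE => //; have [] := smallP (leqnn (small r)).
  (* The power of the product splits because the two factors commute: both products are the value of
     [x] at the same sum of reals. *)
  rewrite !E // mulrDl xD // expgMn // /commute.
  by rewrite -!xD // addrC.
rewrite (powE (k := 1)) ?divr1 ?expg1 //.
by have [] := smallP (leqnn (small t)).
Qed.
End ExtendLocalHomomorphism.

Theorem exists_one_parameter_subgroup (R : realType) n (G : lieGroupType R n)
    (Y : chart R n G -> G -> 'rV[R]_n) :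
  (forall q p c c', atlas c -> atlas c' -> cdom c p -> cdom c' (q * p)%g ->
     Y c' (q * p)%g = tangent_map (fun r => (q * r)%g) c c' p (Y c p)) ->
  (forall c, atlas c -> Ck_on 1 (cimg c) (fun z => Y c (cinv c z))) ->
  exists gam, one_parameter_subgroup Y gam.
Proof.
move=> lY sY; have [c ac c1] := @atlas_cover R n G 1%g.
have [r [d [r0 d0 rU [g [g0 gP]] uniq]]] :=
  local_flow (@cimg_open _ _ _ c) (cimg_cmap c1) (sY c ac).
pose x (t : R) := cinv c (g t).
have gU (t : R) : `|t| < d -> cimg c (g t) by move=> /gP[gr _]; apply: rU; exact: ltW.
have xc (t : R) : `|t| < d -> cdom c (x t) by move=> /gU; exact: cinv_cdom.
have xK (t : R) : `|t| < d -> cmap c (x t) = g t by move=> /gU; exact: cinvK.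
have x0 : x 0 = 1%g by rewrite /x g0 cmapK ?inE.
have cx0 : {for 0, continuous x}.
  apply: continuous_comp.
    by apply: is_derive_continuous; apply: (gP 0 _).2; rewrite normr0.
  by apply: cinv_continuous; rewrite inE g0; exact: cimg_cmap.
have dx (t : R) : `|t| < d -> is_derive t 1 (cmap c \o x) (Y c (x t)).
  move=> td; apply: near_eq_is_derive (gP t td).2.
  by near=> s; rewrite /= xK //; near: s; exact: near_norm_lt.
have nx (t : R) : `|t| < d -> \forall s \near t, cdom c (x s).
  by move=> td; near=> s; apply: xc; near: s; exact: near_norm_lt.
(* Local uniqueness compares only curves that stay in the ball of radius [r] in the chart;
   continuity of the multiplication keeps [x s * x t] there. *)
have [e e0 eP] : exists2 e, 0 < e & forall s t : R, `|s| <= e -> `|t| <= e ->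
    cdom c (x s * x t)%g /\ `|cmap c (x s * x t)%g - cmap c 1%g| <= r.
  pose W := [set p : G | cdom c p /\ `|cmap c p - cmap c 1%g| <= r].
  have W1 : nbhs (1 * 1 : G)%g W.
    rewrite mulg1; apply: filterI.
      by apply: open_nbhs_nbhs; split=> //; exact: cdom_open.
    have := cmap_continuous (mem_set c1) => cm.
    have : \forall p \near (1%g : G), `|cmap c 1%g - cmap c p| <= r.
      by move/cvgrPdist_le : cm => /(_ _ r0).
    by apply: filterS => p; rewrite distrC.
  have [[A B] /= [A1 B1] AB] := @lie_mul_continuous R n G (1%g, 1%g) W W1.
  have nA : \forall s \near (0 : R), A (x s) /\ B (x s).
    by apply: filterI; apply: cx0; rewrite x0.
  have [e e0 eAB] := near_closed_ball nA; exists e => // s t se te.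
  have [As _] : A (x s) /\ B (x s) by apply: eAB; rewrite subr0.
  have [_ Bt] : A (x t) /\ B (x t) by apply: eAB; rewrite subr0.
  exact: (AB (x s, x t) (conj As Bt)).
(* Halving [d] keeps the sum of two admissible times below [d]. *)
pose e1 := Num.min e (d / 2).
have e10 : 0 < e1 by rewrite lt_min e0 divr_gt0.
have e1e (t : R) : `|t| < e1 -> `|t| <= e by rewrite lt_min => /andP[/ltW].
have e1d (t : R) : `|t| < e1 -> `|t| < d / 2 by rewrite lt_min => /andP[].
have dd : d / 2 <= d by rewrite ler_pdivrMr // ler_pMr // ler1n.
have xD (s t : R) : `|s| < e1 -> `|t| < e1 -> x (s + t) = (x s * x t)%g.
  move=> se te.
  have st u : `|u| < e1 -> `|s + u| < d.
    move=> ue; apply: (le_lt_trans (ler_normD _ _)).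
    by have := e1d _ se; have := e1d _ ue; lra.
  have [cxst _] := eP s t (e1e _ se) (e1e _ te).
  rewrite -[RHS](@cmapK _ _ _ c) ?inE // /x; congr (cinv c _).
  (* Two solutions with the same initial value: [g1] is a left translate of the solution, and [Y] is
     left invariant; [g2] is its time shift. *)
  apply/esym; pose g1 u := cmap c (x s * x u)%g; pose g2 u := g (s + u).
  apply: (uniq g1 g2 e1) => //.
  - by rewrite (le_trans _ dd) // ge_min lexx orbT.
  - by rewrite /g1 /g2 x0 mulg1 addr0 xK // (lt_le_trans (e1d _ se)).
  - move=> u ue; have [csu rsu] := eP s u (e1e _ se) (e1e _ ue); split=> //.
    have ud : `|u| < d by exact: lt_le_trans (e1d _ ue) dd.
    rewrite /g1 cmapK ?inE // (lY _ _ _ _ ac ac (xc _ ud) csu).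
    exact: (is_derive_ltrans ac ac csu (nx _ ud) (dx _ ud)).
  - move=> u ue; have [gr dg] := gP _ (st u ue); split; first exact: ltW.
    apply/is_derive_line; move/is_derive_line : dg.
    by under eq_fun do rewrite addrCA.
have [y [yD yx]] := extend_local_homomorphism e10 xD.
have y0 : y 0 = 1%g by rewrite yx ?normr0.
have nyx : \forall s \near (0 : R), x s = y s.
  by near=> s; rewrite yx //; near: s; apply: near_norm_lt; rewrite normr0.
have cy0 : {for 0, continuous y}.
  have : y s @[s --> (0 : R)] --> x 0.
    by apply: cvg_trans cx0; apply: near_eq_cvg; apply: filterS nyx => s ->.
  by rewrite x0 -y0.
exists y; split=> //.
  (* Continuity at 0 is carried to [t] by writing [y s = y t * y (s - t)]. *)
  move=> t; have -> : y = (fun p => (y t * p)%g) \o y \o (fun s => s - t).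
    by apply/funext => s /=; rewrite -yD addrC subrK.
  apply: continuous_comp.
    by apply: continuousB; [exact: cvg_id|exact: cst_continuous].
  rewrite subrr; apply: continuous_comp; first exact: cy0.
  apply: (@continuous_comp _ _ _ (fun p : G => (y t, p)) (fun pq : G * G => (pq.1 * pq.2)%g)).
    by apply: cvg_pair; [exact: cst_continuous|exact: cvg_id].
  exact: lie_mul_continuous.
move=> c' ac' c'1.
(* The velocity at 0 is known in the chart [c] only; left translation by the identity, read from [c]
   to [c'], performs the change of chart. *)
have c'x : cdom c' (1 * x 0)%g by rewrite x0 mulg1.
have d00 : `|0 : R| < d by rewrite normr0.
have := is_derive_ltrans ac ac' c'x (nx _ d00) (dx _ d00).
rewrite -lY ?x0 // ?mulg1 // => dy; apply: near_eq_is_derive dy.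
by apply: filterS nyx => s /= <-; rewrite mul1g.
Unshelve. all: by end_near. Qed.

(** * Fields with constant coefficients in the frame *)

Section FrameFields.
Context {R : realType} {n : nat} {G : lieGroupType R n}.
Variables (h : chart R n G -> G -> 'M[R]_n).
Variable E : n.-tuple (chart R n G -> G -> 'rV[R]_n).
Hypothesis hh : left_invariant_metric h.
Hypothesis hE : orthonormal_basis h E.
Implicit Types (c : chart R n G) (p q : G) (x z u v w : 'rV[R]_n).
Implicit Types (X Y : chart R n G -> G -> 'rV[R]_n).
Local Notation frame := (frame_mx E).

Lemma mul_frame c z u : u *m frame c z = \sum_i u 0 i *: tnth E i c (cinv c z).
Proof.
rewrite mulmx_sum_row; apply: eq_bigr => i _; congr (_ *: _).
by apply/rowP => j; rewrite !mxE.
Qed.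

Lemma delta_frame c z i : delta_mx 0 i *m frame c z = tnth E i c (cinv c z).
Proof. by rewrite -rowE; apply/rowP => j; rewrite !mxE. Qed.

Lemma dder_mul_frame c z u v : atlas c -> cimg c z ->
  dder (fun z => u *m frame c z) z v = u *m dder (frame c) z v.
Proof.
move=> ac cz; have dE := frame_differentiable hE ac cz.
have [_ <-] := is_derive_mulmxl u v dE.
by rewrite -dderE deriveE //; apply: differentiable_mulmx.
Qed.

Lemma lie_bracket_frame i j c p : atlas c -> cdom c p ->
  lie_bracket (tnth E i) (tnth E j) c p
  = frame_bracket h E c (cmap c p) (delta_mx 0 i) (delta_mx 0 j) *m frame c (cmap c p).
Proof.
move=> ac cp; have cz := cimg_cmap cp; have pK : cinv c (cmap c p) = p by rewrite cmapK ?inE.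
have D k v : 'd (fun x => tnth E k c (cinv c x)) (cmap c p) v
    = delta_mx 0 k *m dder (frame c) (cmap c p) v.
  rewrite dderE -dder_mul_frame //; congr (dder _ _ _).
  by apply/funext => z; rewrite delta_frame.
rewrite /frame_bracket -mulmxA (coframe_frame hE) // mulmx1 !delta_frame pK.
by rewrite /lie_bracket; congr (_ - _); exact: D.
Qed.

(** Turns a bracket relation between the fields [E_i] into a value of [frame_bracket], that is, into
    structure constants. *)
Lemma frame_bracket_struct i j c z C : atlas c -> cimg c z ->
  lie_bracket (tnth E i) (tnth E j) c (cinv c z) = C *m frame c z ->
  frame_bracket h E c z (delta_mx 0 i) (delta_mx 0 j) = C.
Proof.
move=> ac cz; rewrite lie_bracket_frame //; last exact: cinv_cdom.
rewrite cinvK // => /(congr1 (mulmxr (coframe_mx h E c z))) /=.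
by rewrite -!mulmxA (frame_coframe hE) // !mulmx1.
Qed.

Lemma frame_bracket_sum c z u w :
  frame_bracket h E c z u w
  = \sum_i u 0 i *: frame_bracket h E c z (delta_mx 0 i) w.
Proof.
have L k v v' : frame_bracket h E c z (k *: v + v') w
    = k *: frame_bracket h E c z v w + frame_bracket h E c z v' w.
  rewrite frame_bracketC frame_bracket_linearr opprD -scalerN.
  by rewrite -!(frame_bracketC h E c z _ w).
have L0 : frame_bracket h E c z 0 w = 0 by rewrite frame_bracketC frame_bracket0r oppr0.
rewrite {1}(row_sum_delta u).
rewrite (big_morph (frame_bracket h E c z ^~ w) (id1 := 0) (op1 := +%R)) //.
  by apply: eq_bigr => i _; rewrite -[_ *: _ in LHS]addr0 L L0 addr0.
by move=> v v'; rewrite -[v in LHS]scale1r L scale1r.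
Qed.

Variables (Y : chart R n G -> G -> 'rV[R]_n) (u : 'rV[R]_n).
Hypothesis YE : forall c p, Y c p = \sum_i u 0 i *: tnth E i c p.

Lemma frame_field c z : Y c (cinv c z) = u *m frame c z.
Proof. by rewrite mul_frame YE. Qed.

Lemma frame_field_left_invariant q p c c' : atlas c -> atlas c' -> cdom c p ->
  cdom c' (q * p)%g ->
  Y c' (q * p)%g = tangent_map (fun r => (q * r)%g) c c' p (Y c p).
Proof.
move=> ac ac' cp cqp; rewrite !YE /tangent_map linear_sum; apply: eq_bigr => i _.
rewrite linearZ; congr (_ *: _); exact: (hE.1 i).2.
Qed.

(** For a fixed direction the derivative is a constant combination of the derivatives of the [E_i],
    whose continuity is part of their smoothness. *)
Lemma frame_field_C1 c : atlas c -> Ck_on 1 (cimg c) (fun z => Y c (cinv c z)).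
Proof.
move=> ac; have YF : (fun z => Y c (cinv c z)) = (fun z => u *m frame c z).
  by apply/funext => z; rewrite frame_field.
have dE z : cimg c z -> differentiable (frame c) z.
  by move=> cz; exact: (frame_differentiable hE ac cz).
rewrite YF; split=> [z cz|v z cz].
  by apply: differentiable_mulmx => //; exact: dE.
have cEi i : {for z, continuous (fun z => dder (fun z => tnth E i c (cinv c z)) z v)}.
  have [[_ sE] _] := hE.1 i; have [_ cE] := sE c ac 1%N.
  by rewrite dder.unlock; exact: cE v z cz.
have cS : {for z, continuous
    (fun z => \sum_i u 0 i *: dder (fun z => tnth E i c (cinv c z)) z v)}.
  apply: cvg_big => [||i _]; [exact: add_continuous|exact: (nbhs_filter z)|].
  have : {for z, continuous (fun z => u 0 i *: dder (fun z => tnth E i c (cinv c z)) z v)}.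
    by apply: continuous_comp; [exact: cEi|exact: scaler_continuous].
  exact.
have DS x : cimg c x -> 'd (fun z => u *m frame c z) x v
    = \sum_i u 0 i *: dder (fun z => tnth E i c (cinv c z)) x v.
  move=> cx; rewrite dderE dder_mul_frame // mulmx_sum_row; apply: eq_bigr => i _.
  congr (_ *: _); rewrite rowE -dder_mul_frame //; congr (dder _ _ _).
  by apply/funext => y; rewrite delta_frame.
have : 'd (fun z => u *m frame c z) x v @[x --> z]
    --> \sum_i u 0 i *: dder (fun z => tnth E i c (cinv c z)) z v.
  apply: cvg_trans cS; apply: near_eq_cvg; first exact: (nbhs_filter z).
  by apply: filterS (near_cimg cz) => x /DS ->.
by rewrite -DS.
Qed.

(** The two halves differ in scope: a geodesic [exp (t Y)] passes through the identity, which yields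
    the condition there, whereas the converse checks the equation all along the curve. Constant
    structure constants later close the gap. *)
Lemma geodesic_vector_frame_bracket X : left_invariant_vfield X ->
  (forall c p, atlas c -> cdom c p ->
     Num.sqrt (inner h c p (X c p) (X c p)) < 1) ->
  douglas_type (randers h X) -> ~ vfield_eq Y 0 ->
  (geodesic_vector (randers h X) Y ->
     forall c w, atlas c -> cdom c 1%g ->
     dotv u (frame_bracket h E c (cmap c 1%g) u w) = 0) /\
  ((forall c z w, atlas c -> cimg c z -> dotv u (frame_bracket h E c z u w) = 0) ->
     geodesic_vector (randers h X) Y).
Proof.
move=> lX X1 dF Y0; have [b bE] := left_invariant_coord hh hE lX.
have u0 : u != 0.
  apply/eqP => u0; apply: Y0 => c p _ _; rewrite YE u0.
  by rewrite big1 // => i _; rewrite mxE scale0r.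
have lY := frame_field_left_invariant.
have dY c z : atlas c -> cimg c z -> differentiable (fun z => Y c (cinv c z)) z.
  by move=> ac cz; have [+ _] := frame_field_C1 ac; apply.
have YF c : (fun z => Y c (cinv c z)) = (fun z => u *m frame c z).
  by apply/funext => z; rewrite frame_field.
have Yp c p : cdom c p -> Y c p = u *m frame c (cmap c p).
  by move=> cp; rewrite -frame_field cmapK ?inE.
have defect c p : atlas c -> cdom c p ->
    (dder (fun z => Y c (cinv c z)) (cmap c p) (Y c p)
       = - 2 *: spray (randers h X) c (cmap c p) (Y c p))
    <-> (forall w, dotv u (frame_bracket h E c (cmap c p) u w) = 0).
  move=> ac cp; have cz := cimg_cmap cp.
  rewrite -(geodesic_defect_eq0 hh hE bE X1 dF ac cz u0) Yp // YF dder_mul_frame //.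
  rewrite addrC; split=> [->|/eqP]; first by rewrite scaleNr addNr.
  by rewrite addr_eq0 scaleNr => /eqP.
split=> [[_ [gam ogam ggam]] c w ac c1|H].
  have [_ gD _] := ogam.
  have g0 : gam 0 = 1%g by apply: (mulgI (gam 0)); rewrite -gD addr0 mulg1.
  have /(_ 0 c ac) := (one_parameter_subgroup_geodesic lY dY (randers h X) ogam).1 ggam.
  by rewrite g0 => /(_ c1) /(defect _ _ ac c1) ->.
split=> //; have [gam ogam] := exists_one_parameter_subgroup lY frame_field_C1.
exists gam => //; apply/(one_parameter_subgroup_geodesic lY dY) => // t c ac ct.
by apply/defect => // w; apply: H => //; exact: cimg_cmap.
Qed.
End FrameFields.

(** * The Lie algebra l_{5,7} *)

Lemma dotv_frame_bracket (R : realType) n (G : lieGroupType R n)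
    (h : chart R n G -> G -> 'M[R]_n) (E : n.-tuple (chart R n G -> G -> 'rV[R]_n)) c z
    (u v w : 'rV[R]_n) :
  dotv v (frame_bracket h E c z u w)
  = \sum_i \sum_j u 0 i * w 0 j
      * dotv v (frame_bracket h E c z (delta_mx 0 i) (delta_mx 0 j)).
Proof.
have S (I : finType) (F : I -> 'rV[R]_n) : dotv v (\sum_i F i) = \sum_i dotv v (F i).
  by apply: (big_morph (dotv v)) => [x y|]; [exact: dotvDr|exact: dotv0].
rewrite frame_bracket_sum S; apply: eq_bigr => i _.
rewrite dotvZr frame_bracketC frame_bracket_sum dotvNr S mulrN -mulNr mulr_sumr.
apply: eq_bigr => j _; rewrite dotvZr [in RHS]frame_bracketC dotvNr; ring.
Qed.

Section L57.
Context {R : realType} {G : lieGroupType R 5}.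
Variables (h : chart R 5 G -> G -> 'M[R]_5).
Variables (E1 E2 E3 E4 E5 : chart R 5 G -> G -> 'rV[R]_5) (a b c d f g : R).
Let E := [tuple E1; E2; E3; E4; E5].
Hypothesis hE : orthonormal_basis h E.
Hypothesis E12 : vfield_eq (lie_bracket E1 E2) (a *: E3 + b *: E4 + c *: E5).
Hypothesis E13 : vfield_eq (lie_bracket E1 E3) (d *: E4 + f *: E5).
Hypothesis E14 : vfield_eq (lie_bracket E1 E4) (g *: E5).
Hypothesis E15 : vfield_eq (lie_bracket E1 E5) 0.
Hypothesis E23 : vfield_eq (lie_bracket E2 E3) 0.
Hypothesis E24 : vfield_eq (lie_bracket E2 E4) 0.
Hypothesis E25 : vfield_eq (lie_bracket E2 E5) 0.
Hypothesis E34 : vfield_eq (lie_bracket E3 E4) 0.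
Hypothesis E35 : vfield_eq (lie_bracket E3 E5) 0.
Hypothesis E45 : vfield_eq (lie_bracket E4 E5) 0.

Let i1 : 'I_5 := ord0.
Let i2 : 'I_5 := lift ord0 ord0.
Let i3 : 'I_5 := lift ord0 (lift ord0 ord0).
Let i4 : 'I_5 := lift ord0 (lift ord0 (lift ord0 ord0)).
Let i5 : 'I_5 := lift ord0 (lift ord0 (lift ord0 (lift ord0 ord0))).

(** The right side involves neither the point nor the chart, so the condition at the identity and
    the condition everywhere coincide. *)
Lemma l57_dotv_bracket ch z (v u w : 'rV[R]_5) : atlas ch -> cimg ch z ->
  dotv v (frame_bracket h E ch z u w)
  = (u 0 i1 * w 0 i2 - u 0 i2 * w 0 i1) * (a * v 0 i3 + b * v 0 i4 + c * v 0 i5)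
    + (u 0 i1 * w 0 i3 - u 0 i3 * w 0 i1) * (d * v 0 i4 + f * v 0 i5)
    + (u 0 i1 * w 0 i4 - u 0 i4 * w 0 i1) * (g * v 0 i5).
Proof.
move=> ac cz; have cp := cinv_cdom cz.
pose B i j := dotv v (frame_bracket h E ch z (delta_mx 0 i) (delta_mx 0 j)).
have Bii i : B i i = 0 by rewrite /B frame_bracket_self dotv0.
have BC i j : B i j = - B j i by rewrite /B frame_bracketC dotvNr.
have BE i j C : lie_bracket (tnth E i) (tnth E j) ch (cinv ch z) = C *m frame_mx E ch z ->
    B i j = dotv v C.
  by move=> /(frame_bracket_struct hE ac cz); rewrite /B => ->.
have B0 i j : lie_bracket (tnth E i) (tnth E j) ch (cinv ch z) = 0 -> B i j = 0.
  by move=> l0; rewrite (BE i j 0) ?dotv0 // mul0mx.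
have B12 : B i1 i2 = a * v 0 i3 + b * v 0 i4 + c * v 0 i5.
  rewrite (BE i1 i2 (a *: delta_mx 0 i3 + b *: delta_mx 0 i4 + c *: delta_mx 0 i5)).
    by rewrite !dotvDr !dotvZr !dotv_delta.
  rewrite !mulmxDl -!scalemxAl !delta_frame; exact: (E12 ac cp).
have B13 : B i1 i3 = d * v 0 i4 + f * v 0 i5.
  rewrite (BE i1 i3 (d *: delta_mx 0 i4 + f *: delta_mx 0 i5)).
    by rewrite !dotvDr !dotvZr !dotv_delta.
  rewrite !mulmxDl -!scalemxAl !delta_frame; exact: (E13 ac cp).
have B14 : B i1 i4 = g * v 0 i5.
  rewrite (BE i1 i4 (g *: delta_mx 0 i5)) ?dotvZr ?dotv_delta //.
  rewrite -scalemxAl delta_frame; exact: (E14 ac cp).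
have B15 : B i1 i5 = 0 by apply: B0; exact: (E15 ac cp).
have B23 : B i2 i3 = 0 by apply: B0; exact: (E23 ac cp).
have B24 : B i2 i4 = 0 by apply: B0; exact: (E24 ac cp).
have B25 : B i2 i5 = 0 by apply: B0; exact: (E25 ac cp).
have B34 : B i3 i4 = 0 by apply: B0; exact: (E34 ac cp).
have B35 : B i3 i5 = 0 by apply: B0; exact: (E35 ac cp).
have B45 : B i4 i5 = 0 by apply: B0; exact: (E45 ac cp).
rewrite dotv_frame_bracket.
under eq_bigr do under eq_bigr do rewrite -/(B _ _).
rewrite !big_ord_recl !big_ord0 -/i2 -/i3 -/i4 -/i5 -/i1 !Bii.
rewrite (BC i2 i1) (BC i3 i1) (BC i4 i1) (BC i5 i1) (BC i3 i2) (BC i4 i2) (BC i5 i2).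
rewrite (BC i4 i3) (BC i5 i3) (BC i5 i4).
rewrite B12 B13 B14 B15 B23 B24 B25 B34 B35 B45; ring.
Qed.
End L57.

Theorem theorem3p3 (R : realType) (G : lieGroupType R 5)
    (h : chart R 5 G -> G -> 'M[R]_5)
    (E1 E2 E3 E4 E5 X : chart R 5 G -> G -> 'rV[R]_5)
    (a b c d f g : R) :
  simply_connected R G ->
  nilpotent_group G ->
  left_invariant_metric h ->
  orthonormal_basis h [tuple E1; E2; E3; E4; E5] ->
  vfield_eq (lie_bracket E1 E2) (a *: E3 + b *: E4 + c *: E5) ->
  vfield_eq (lie_bracket E1 E3) (d *: E4 + f *: E5) ->
  vfield_eq (lie_bracket E1 E4) (g *: E5) ->
  vfield_eq (lie_bracket E1 E5) 0 ->
  vfield_eq (lie_bracket E2 E3) 0 ->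
  vfield_eq (lie_bracket E2 E4) 0 ->
  vfield_eq (lie_bracket E2 E5) 0 ->
  vfield_eq (lie_bracket E3 E4) 0 ->
  vfield_eq (lie_bracket E3 E5) 0 ->
  vfield_eq (lie_bracket E4 E5) 0 ->
  0 < a -> 0 < d -> 0 < g ->
  0 < b \/ (b = 0 /\ 0 <= f) ->
  left_invariant_vfield X ->
  (forall ch p, atlas ch -> cdom ch p ->
     Num.sqrt (inner h ch p (X ch p) (X ch p)) < 1) ->
  douglas_type (randers h X) ->
  forall y1 y2 y3 y4 y5 : R,
  let Y := y1 *: E1 + y2 *: E2 + y3 *: E3 + y4 *: E4 + y5 *: E5 in
  ~ vfield_eq Y 0 ->
  (geodesic_vector (randers h X) Y <->
     (exists u v : R, vfield_eq Y (u *: E1 + v *: E2)) \/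
     (orthogonal_vfields h Y E1 /\
      y2 * (a * y3 + b * y4 + c * y5) + y3 * (d * y4 + f * y5)
        + g * y4 * y5 = 0)).
Proof.
move=> _ _ hh hE E12 E13 E14 E15 E23 E24 E25 E34 E35 E45 a0 d0 g0 _ lX X1 dF
  y1 y2 y3 y4 y5 Y Y0.
set E := [tuple E1; E2; E3; E4; E5] in hE.
pose u : 'rV[R]_5 := \row_i tnth [tuple y1; y2; y3; y4; y5] i.
pose Q := y2 * (a * y3 + b * y4 + c * y5) + y3 * (d * y4 + f * y5) + g * y4 * y5.
have u1 : u 0 ord0 = y1 by rewrite mxE.
have u2 : u 0 (lift ord0 ord0) = y2 by rewrite mxE.
have u3 : u 0 (lift ord0 (lift ord0 ord0)) = y3 by rewrite mxE.
have u4 : u 0 (lift ord0 (lift ord0 (lift ord0 ord0))) = y4 by rewrite mxE.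
have u5 : u 0 (lift ord0 (lift ord0 (lift ord0 (lift ord0 ord0)))) = y5 by rewrite mxE.
have YE ch p : Y ch p = \sum_i u 0 i *: tnth E i ch p.
  by rewrite !big_ord_recl big_ord0 !mxE addr0 !addrA.
have pairing ch z w : atlas ch -> cimg ch z ->
    dotv u (frame_bracket h E ch z u w)
    = - Q * w 0 ord0 + y1 * ((a * y3 + b * y4 + c * y5) * w 0 (lift ord0 ord0)
      + (d * y4 + f * y5) * w 0 (lift ord0 (lift ord0 ord0))
      + g * y5 * w 0 (lift ord0 (lift ord0 (lift ord0 ord0)))).
  move=> ac cz.
  rewrite (l57_dotv_bracket hE E12 E13 E14 E15 E23 E24 E25 E34 E35 E45) //.
  by rewrite u1 u2 u3 u4 u5 /Q; ring.
have [ch ac c1] := @atlas_cover R 5 G 1%g.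
have [geo1 geo2] := geodesic_vector_frame_bracket hh hE YE lX X1 dF Y0.
have Y1E : orthogonal_vfields h Y E1 <-> y1 = 0.
  have inY ch' p : atlas ch' -> cdom ch' p -> inner h ch' p (Y ch' p) (E1 ch' p) = y1.
    move=> ac' cp; have pK : cinv ch' (cmap ch' p) = p by rewrite cmapK ?inE.
    rewrite -pK (frame_field YE) -[E1 _ _](delta_frame E ch' (cmap ch' p) ord0).
    by rewrite (frame_metric hE) ?dotv_delta ?mxE //; exact: cimg_cmap.
  by split=> [/(_ ch 1%g ac c1)|y10 ch' p ac' cp]; rewrite inY.
have YspanE : (exists s t : R, vfield_eq Y (s *: E1 + t *: E2)) <->
    [/\ y3 = 0, y4 = 0 & y5 = 0].
  split=> [[s [t Yst]]|[y30 y40 y50]]; last first.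
    by exists y1, y2 => ch' p _ _; rewrite /Y y30 y40 y50 !scale0r !addr0.
  have cz := cimg_cmap c1; have pK : cinv ch (cmap ch 1%g) = 1%g by rewrite cmapK ?inE.
  (* Coordinates in the frame are unique, so comparing the two fields at the identity is enough. *)
  have uE : u = s *: delta_mx 0 ord0 + t *: delta_mx 0 (lift ord0 ord0).
    rewrite -[u]mulmx1 -[RHS]mulmx1 -(frame_coframe hE ac cz).
    rewrite [LHS]mulmxA [RHS]mulmxA; congr (_ *m _).
    rewrite -(frame_field YE) mulmxDl -!scalemxAl !delta_frame pK.
    exact: (Yst ch 1%g ac c1).
  have uk k : u 0 k = s * (k == ord0)%:R + t * (k == lift ord0 ord0)%:R.
    by rewrite uE !mxE !eqxx.
  by split; rewrite -?u3 -?u4 -?u5 uk !mulr0 addr0.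
rewrite YspanE Y1E -/Q; split=> [gY|H]; last first.
  apply: geo2 => ch' z w ac' cz; rewrite pairing //.
  case: H => [[y30 y40 y50]|[-> ->]]; last by rewrite mul0r oppr0 mul0r addr0.
  by rewrite /Q y30 y40 y50; ring.
have key (w : 'rV[R]_5) : - Q * w 0 ord0
    + y1 * ((a * y3 + b * y4 + c * y5) * w 0 (lift ord0 ord0)
      + (d * y4 + f * y5) * w 0 (lift ord0 (lift ord0 ord0))
      + g * y5 * w 0 (lift ord0 (lift ord0 (lift ord0 ord0)))) = 0.
  by rewrite -(pairing ch _ w ac (cimg_cmap c1)); exact: geo1.
have Q0 : Q = 0.
  have := key (delta_mx 0 ord0); rewrite !mxE /= !(mulr0, mulr1, addr0) => /eqP.
  by rewrite oppr_eq0 => /eqP.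
(* For [y1 <> 0] the test vectors [E_4], [E_3], [E_2], in this order, solve the triangular system
   from the bottom: [g], [d], [a] are positive, so [y5], [y4], [y3] vanish in turn. *)
have [y10|y10] := eqVneq y1 0; [by right|left].
have gy5 : g * y5 = 0.
  apply: (mulfI y10); have := key (delta_mx 0 (lift ord0 (lift ord0 (lift ord0 ord0)))).
  by rewrite !mxE /= !(mulr0, mulr1, add0r, addr0).
have y50 : y5 = 0 by apply/eqP; move/eqP: gy5; rewrite mulf_eq0 gt_eqF.
have dy4 : d * y4 + f * y5 = 0.
  apply: (mulfI y10); have := key (delta_mx 0 (lift ord0 (lift ord0 ord0))).
  by rewrite !mxE /= !(mulr0, mulr1, add0r, addr0).
have y40 : y4 = 0.
  by apply/eqP; move/eqP: dy4; rewrite y50 mulr0 addr0 mulf_eq0 gt_eqF.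
have ay3 : a * y3 + b * y4 + c * y5 = 0.
  apply: (mulfI y10); have := key (delta_mx 0 (lift ord0 ord0)).
  by rewrite !mxE /= !(mulr0, mulr1, add0r, addr0).
have y30 : y3 = 0.
  by apply/eqP; move/eqP: ay3; rewrite y50 y40 !mulr0 !addr0 mulf_eq0 gt_eqF.
by [].
Qed.
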